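(* Let $\Psi\in\mathcal C_I\cup\mathcal C_d$ and let $\Omega\subseteq S^{n-1}$ be a closed set not contained in any closed hemisphere of $S^{n-1}$. Let $f\in C^+(\Omega)$, $g\in C(\Omega)$, and for $|\varepsilon|$ sufficiently small let $f_\varepsilon\in C^+(\Omega)$ be defined by $\Psi(\xi,f_\varepsilon(\xi))=\Psi(\xi,f(\xi))+\varepsilon g(\xi)$, $\xi\in\Omega$. Then $$\lim_{\varepsilon\to0}\frac{V([f_\varepsilon])-V([f])}{\varepsilon}=\int_\Omega g(u)\,dS_\Psi([f],u),$$ where $V$ denotes volume (Lebesgue measure in $\mathbb R^n$).
   Context: $S^{n-1}$ is the unit sphere of $\mathbb R^n$, $n\ge2$, $d\xi$ spherical Lebesgue measure. $\mathscr K^n_{(o)}$: compact convex sets in $\mathbb R^n$ with the origin in their interior. For $K\in\mathscr K^n_{(o)}$: $h_K(x)=\max\{x\cdot y:y\in K\}$, $\rho_K(x)=\max\{t\ge0:tx\in K\}$; $\pmb\alpha_K(\xi)$ is the set of outer unit normals of $K$ at $\rho_K(\xi)\xi$, a singleton $\{\alpha_K(\xi)\}$ for a.e. $\xi$; $\pmb\alpha^*_K(\omega)=\{\xi:\pmb\alpha_K(\xi)\cap\omega\ne\emptyset\}$. $\mathcal C$: functions $\Psi:S^{n-1}\times(0,\infty)\to\mathbb R$ with $\Psi$, $\Psi_t=\partial\Psi/\partial t$ continuous; $\mathcal C_I=\{\Psi\in\mathcal C:\Psi_t>0\}$, $\mathcal C_d=\{\Psi\in\mathcal C:\Psi_t<0\}$.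 The Musielak–Orlicz surface area measure is $S_\Psi(K,\omega)=\int_{\pmb\alpha^*_K(\omega)}\frac{\rho_K(\xi)^n}{h_K(\alpha_K(\xi))\Psi_t(\alpha_K(\xi),h_K(\alpha_K(\xi)))}d\xi$ for Borel $\omega$. $C(\Omega)$: continuous functions on $\Omega$; $C^+(\Omega)$: strictly positive ones; $[f]=\bigcap_{\xi\in\Omega}\{x:x\cdot\xi\le f(\xi)\}$ (Wulff shape). *)

(* Defs.v *)
From HB Require Import structures.
From mathcomp Require Import all_boot all_order all_algebra.
From mathcomp Require Import all_classical all_reals all_analysis.
Set Implicit Arguments.
Unset Strict Implicit.
Unset Printing Implicit Defensive.
Import Order.TTheory GRing.Theory Num.Theory.
Import numFieldNormedType.Exports.
Local Open Scope classical_set_scope.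
Local Open Scope ring_scope.

Section Defs.
Context {R : realType} {n : nat}.
Local Notation V := 'rV[R]_n.

Definition dotp (x y : V) : R := \sum_(i < n) x ord0 i * y ord0 i.
Definition enorm (x : V) : R := Num.sqrt (dotp x x).

Definition sphere : set V := [set x | enorm x = 1].

Definition in_closed_hemisphere (Om : set V) : Prop :=
  exists v, sphere v /\ Om `<=` [set x | sphere x /\ 0 <= dotp x v].

Definition wulff (Om : set V) (f : V -> R) : set V :=
  [set x | forall xi, Om xi -> dotp x xi <= f xi].

Definition supp_fun (K : set V) (x : V) : R := sup [set dotp x y | y in K].
Definition radial_fun (K : set V) (x : V) : R :=
  sup [set t | 0 <= t /\ K (t *: x)].

Definition normals (K : set V) (p : V) : set V :=
  [set u | sphere u /\ dotp p u = supp_fun K u].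

Definition rgauss (K : set V) (xi : V) : set V :=
  normals K (radial_fun K xi *: xi).
(** alpha_K(xi): the (a.e. unique) outer unit normal; a choice otherwise. *)
Definition alphaK (K : set V) (xi : V) : V := xget 0 (rgauss K xi).
Definition alpha_star (K : set V) (om : set V) : set V :=
  [set xi | sphere xi /\ exists2 u, rgauss K xi u & om u].

(** Lebesgue (outer) measure on R^n: the outer measure generated (via the
    library's measure-extension construction mu^* ) by the volume of closed
    boxes, over the sigma-algebra generated by boxes. *)
Definition cbox (a b : V) : set V :=
  [set x | forall i, a ord0 i <= x ord0 i <= b ord0 i].
Definition boxes : set (set V) := [set A | exists a b, A = cbox a b].
Definition BoxType := g_sigma_algebraType boxes.

Definition box_vol (A : set BoxType) : \bar R :=
  if `[< A = set0 >] then 0%E else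
  ereal_inf [set (\prod_(i < n) Num.max (ab.2 ord0 i - ab.1 ord0 i) 0)%:E
            | ab in [set ab : V * V | A = cbox ab.1 ab.2]].

Lemma box_vol0 : box_vol set0 = 0%E.
Proof. by rewrite /box_vol asboolT. Qed.

Lemma box_vol_ge0 A : (0 <= box_vol A)%E.
Proof.
rewrite /box_vol; case: ifPn => // _.
apply: le_ereal_inf_tmp => _ [ab _ <-]; rewrite lee_fin.
by apply: prodr_ge0 => i _; rewrite le_max lexx orbT.
Qed.

Definition lebesgue_outer (A : set V) : \bar R := mu_ext box_vol (A : set BoxType).

Lemma lebesgue_outer0 : lebesgue_outer set0 = 0%E.
Proof. exact: (mu_ext0 box_vol0 box_vol_ge0). Qed.
Lemma lebesgue_outer_ge0 A : (0 <= lebesgue_outer A)%E.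
Proof. exact: (mu_ext_ge0 box_vol_ge0). Qed.
Lemma le_lebesgue_outer : {homo lebesgue_outer : A B / A `<=` B >-> (A <= B)%E}.
Proof. by move=> A B AB; exact: (@le_mu_ext _ BoxType R box_vol). Qed.
Lemma lebesgue_outer_sigma_subadditive : sigma_subadditive lebesgue_outer.
Proof. exact: (mu_ext_sigma_subadditive box_vol_ge0). Qed.

(** Volume V(K) (n-dimensional Lebesgue measure; finite for compact K). *)
Definition volume (K : set V) : R := fine (lebesgue_outer K).

(** Spherical Lebesgue measure on S^{n-1}:
    sigma(A) = n * lambda_n({ t x | x in A /\ S^{n-1}, 0 < t <= 1 }). *)
Definition cone (A : set V) : set V :=
  [set y | exists t x, [/\ 0 < t <= 1, A x, sphere x & y = t *: x]].

Definition sph_outer (A : set V) : \bar R := (n%:R)%:E * lebesgue_outer (cone A).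

Lemma cone0 : cone set0 = set0.
Proof. by apply/seteqP; split => // y [t [x []]]. Qed.

Lemma sph_outer0 : sph_outer set0 = 0%E.
Proof. by rewrite /sph_outer cone0 lebesgue_outer0 mule0. Qed.
Lemma sph_outer_ge0 A : (0 <= sph_outer A)%E.
Proof. by apply: mule_ge0 => //; exact: lebesgue_outer_ge0. Qed.
Lemma le_sph_outer : {homo sph_outer : A B / A `<=` B >-> (A <= B)%E}.
Proof.
move=> A B AB; apply: lee_pmul => //; first exact: lebesgue_outer_ge0.
apply: le_lebesgue_outer => y [t [x [t01 Ax Sx ->]]].
by exists t, x; split => //; exact: AB.
Qed.
Lemma cone_bigcup (F : (set V)^nat) :
  cone (\bigcup_k F k) = \bigcup_k cone (F k).
Proof.
apply/seteqP; split.
- by move=> y [t [x [t01 [k _ Fx] Sx ->]]]; exists k => //; exists t, x.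
- move=> y [k _ [t [x [t01 Fx Sx ->]]]]; exists t, x; split => //.
  by exists k.
Qed.
Lemma sph_outer_sigma_subadditive : sigma_subadditive sph_outer.
Proof.
move=> F; rewrite /sph_outer cone_bigcup nneseriesZl; last first.
  by move=> i _; exact: lebesgue_outer_ge0.
apply: lee_pmul => //; first exact: lebesgue_outer_ge0.
exact: lebesgue_outer_sigma_subadditive.
Qed.

HB.instance Definition _ := isOuterMeasure.Build R V sph_outer
  sph_outer0 sph_outer_ge0 le_sph_outer sph_outer_sigma_subadditive.

(** The measurable space carrying spherical Lebesgue measure (Caratheodory
    measurable sets of sph_outer; contains the Borel subsets of S^{n-1}). *)
Definition sph_om : {outer_measure set V -> \bar R} := sph_outer.
Definition SphType := caratheodory_type sph_om.
Definition sph_measure : {measure set SphType -> \bar R} :=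
  (sph_om : set SphType -> \bar R).

Definition BorelType := g_sigma_algebraType [set A : set V | open A].

Definition Psi_t (Psi : V -> R -> R) (xi : V) (t : R) : R := derive1 (Psi xi) t.

Definition dom_St : set (V * R) := [set p | sphere p.1 /\ 0 < p.2].
Definition class_C (Psi : V -> R -> R) : Prop :=
  [/\ {within dom_St, continuous (fun p : V * R => Psi p.1 p.2)},
      (forall xi t, sphere xi -> 0 < t -> derivable (Psi xi) t 1) &
      {within dom_St, continuous (fun p : V * R => Psi_t Psi p.1 p.2)}].
Definition class_CI (Psi : V -> R -> R) : Prop :=
  class_C Psi /\ (forall xi t, sphere xi -> 0 < t -> 0 < Psi_t Psi xi t).
Definition class_Cd (Psi : V -> R -> R) : Prop :=
  class_C Psi /\ (forall xi t, sphere xi -> 0 < t -> Psi_t Psi xi t < 0).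

Definition SPsi_density (Psi : V -> R -> R) (K : set V) (xi : V) : R :=
  radial_fun K xi ^+ n /
  (supp_fun K (alphaK K xi) * Psi_t Psi (alphaK K xi) (supp_fun K (alphaK K xi))).
Definition SPsi (Psi : V -> R -> R) (K : set V) (om : set V) : \bar R :=
  (\int[sph_measure]_(xi in (alpha_star K om : set SphType))
     (SPsi_density Psi K xi)%:E)%E.

End Defs.

(* Main.v *)
Require Import Defs.
From HB Require Import structures.
From mathcomp Require Import all_boot all_order all_algebra.
From mathcomp Require Import all_classical all_reals all_analysis measurable_realfun.
From mathcomp Require Import ring lra.
Set Implicit Arguments.
Unset Strict Implicit.
Unset Printing Implicit Defensive.
Import Order.TTheory GRing.Theory Num.Theory.
Import numFieldNormedType.Exports.
Local Open Scope classical_set_scope.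
Local Open Scope ring_scope.

(** Write P = {u / f(u) : u in Om}. The gauge of the body [f] is the support
    function m of P, so the radial function of [f] is 1/m, and in polar
    coordinates V([f]) = (1/n) int_{S^(n-1)} m^(-n). At a direction xi where
    x.u/f(u) has a unique maximizer u over Om, Danskin's envelope argument
    differentiates the perturbed gauge in e, and dominated convergence passes
    to the integral. Directions xi with several outer normals are null: two
    maximizers over the polar body differ in some coordinate i, are separated
    there by rationals a < b, and the closed set of points with such a pair
    meets each line parallel to the i-th axis at most once (monotonicity of
    the maximizer), hence has infinitely many disjoint translates inside a
    bounded set. The polar formula and the passage from int g dS_Psi to the
    sphere both compare two additive functions of level sets
    {a <= F < b} that differ by at most (b - a) times a third one; repeated
    bisection shows that they agree. Only translation invariance, scaling and
    finiteness on bounded sets of Lebesgue measure are needed, not its value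
    on boxes. *)

(** * Euclidean space and support functions *)

(** Two obstacles shape the development. [fe e] is given only implicitly, one [e] at a time, so its
    closeness to [f], uniformly over [Om], has to be extracted from the compactness of [Om] and the
    sign of $\Psi_t$. Since the gauge is a maximum over the fixed index set [Om], a bound uniform in
    [u] passes to it at once; this is why the gauge, not the body, is perturbed. Secondly, [alphaK]
    is an arbitrary choice at directions with several normals. Limits and measurability are
    therefore studied on [wulff_regular], where it is continuous with values in [Om]. The regular
    set of [f] alone serves for all perturbed bodies, because the polar formula ignores null sets.
    The increasing and decreasing classes are treated together through a constant $s=\pm1$ with
    $s\Psi_t>0$. *)

Section Euclidean.
Context {R : realType} {n : nat}.
Local Notation V := 'rV[R]_n.
Implicit Types (x y z : V) (P Q : set V).

Lemma dotpC x y : dotp x y = dotp y x.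
Proof. by apply: eq_bigr => i _; rewrite mulrC. Qed.

Lemma dotpDl x y z : dotp (x + y) z = dotp x z + dotp y z.
Proof. by rewrite -big_split; apply: eq_bigr => i _; rewrite mxE mulrDl. Qed.

Lemma dotpZl (a : R) x y : dotp (a *: x) y = a * dotp x y.
Proof. by rewrite /dotp mulr_sumr; apply: eq_bigr => i _; rewrite mxE mulrA. Qed.

Lemma dotpNl x y : dotp (- x) y = - dotp x y.
Proof. by rewrite -scaleN1r dotpZl mulN1r. Qed.

Lemma dotpBl x y z : dotp (x - y) z = dotp x z - dotp y z.
Proof. by rewrite dotpDl dotpNl. Qed.

Lemma dotpZr (a : R) x y : dotp x (a *: y) = a * dotp x y.
Proof. by rewrite dotpC dotpZl dotpC. Qed.

Lemma dotpNr x y : dotp x (- y) = - dotp x y.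
Proof. by rewrite dotpC dotpNl dotpC. Qed.

Lemma dot0p x : dotp 0 x = 0.
Proof. by rewrite -(scale0r x) dotpZl mul0r. Qed.

Lemma dotp_delta i x : dotp (delta_mx ord0 i) x = x ord0 i.
Proof.
rewrite /dotp (bigD1 i)//= mxE !eqxx mul1r big1 ?addr0// => j ji.
by rewrite mxE eqxx (negbTE ji) mul0r.
Qed.

Lemma dotpp_ge0 x : 0 <= dotp x x.
Proof. by apply: sumr_ge0 => i _; rewrite -expr2 sqr_ge0. Qed.

Lemma dotpp_eq0 x : (dotp x x == 0) = (x == 0).
Proof.
apply/eqP/eqP => [|->]; last by rewrite dot0p.
move/eqP; rewrite /dotp psumr_eq0 => [/allP x0|i _]; last first.
  by rewrite -expr2 sqr_ge0.
apply/rowP => i; rewrite mxE; apply/eqP.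
by have := x0 i (mem_index_enum _); rewrite -expr2 sqrf_eq0.
Qed.

Lemma normr_coord x i : `|x ord0 i| <= `|x|.
Proof. by rewrite [leRHS]mx_normrE; apply: (le_bigmax _ _ (ord0, i)). Qed.

Lemma normr_dotp x y : `|dotp x y| <= n%:R * `|x| * `|y|.
Proof.
rewrite /dotp (le_trans (ler_norm_sum _ _ _))//.
rewrite (@le_trans _ _ (\sum_(i < n) `|x| * `|y|))//; last first.
  by rewrite sumr_const card_ord -mulrA mulr_natl.
by apply: ler_sum => i _; rewrite normrM ler_pM// normr_coord.
Qed.

Lemma cvg_dotp (T : Type) (F : set_system T) {FF : Filter F}
    (u v : T -> V) (a b : V) : u @ F --> a -> v @ F --> b ->
  (fun t => dotp (u t) (v t)) @ F --> dotp a b.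
Proof.
move=> ua vb; rewrite /dotp.
apply: (@cvg_big _ _ +%R 0 _ _ _ F) => [|i _]; first exact: add_continuous.
apply: cvgM.
  by apply: (@cvg_comp _ _ _ u (fun M : V => M ord0 i) F) ua _; exact: coord_continuous.
by apply: (@cvg_comp _ _ _ v (fun M : V => M ord0 i) F) vb _; exact: coord_continuous.
Qed.

Lemma dotp_continuousr x : continuous (dotp x).
Proof. by move=> y; apply: (@cvg_dotp _ (nbhs y) _ (cst x) id); [exact: cvg_cst |]. Qed.

Lemma enorm_continuous : continuous (@enorm R n).
Proof.
move=> x; apply: (@cvg_comp _ _ _ (fun y => dotp y y) Num.sqrt (nbhs x) (nbhs (dotp x x))).
  by apply: (@cvg_dotp _ (nbhs x) _ id id).
exact: sqrt_continuous.
Qed.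

Lemma enorm_ge0 x : 0 <= enorm x. Proof. exact: sqrtr_ge0. Qed.

Lemma enormZ (a : R) x : enorm (a *: x) = `|a| * enorm x.
Proof.
by rewrite /enorm dotpZl dotpZr mulrA -expr2 sqrtrM ?sqr_ge0// sqrtr_sqr.
Qed.

Lemma enorm_eq0 x : (enorm x == 0) = (x == 0).
Proof. by rewrite sqrtr_eq0 -dotpp_eq0 eq_le dotpp_ge0 andbT. Qed.

Lemma enorm0 : enorm (0 : V) = 0.
Proof. by apply/eqP; rewrite enorm_eq0. Qed.

Lemma enorm_gt0 x : (0 < enorm x) = (x != 0).
Proof. by rewrite lt_neqAle enorm_ge0 andbT eq_sym enorm_eq0. Qed.

Lemma normr_le_enorm x : `|x| <= enorm x.
Proof.
rewrite [leLHS]mx_normrE; apply/bigmax_leP; split=> [|[i j] _ /=].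
  exact: enorm_ge0.
rewrite (ord1 i) /enorm -sqrtr_sqr ler_wsqrtr// /dotp (bigD1 j)//= -expr2.
by rewrite lerDl sumr_ge0// => k _; rewrite -expr2 sqr_ge0.
Qed.

Lemma sphere_neq0 x : sphere x -> x != 0.
Proof. by rewrite /sphere/= => x1; rewrite -enorm_gt0 x1. Qed.

Lemma dotp_sphere x : sphere x -> dotp x x = 1.
Proof.
rewrite /sphere/= /enorm => x1.
by rewrite -[LHS]sqr_sqrtr ?dotpp_ge0// x1 expr1n.
Qed.

Lemma normr_sphere x : sphere x -> `|x| <= 1.
Proof. by move=> <-; exact: normr_le_enorm. Qed.

Lemma sphere_normalize x : x != 0 -> sphere ((enorm x)^-1 *: x).
Proof.
move=> x0; rewrite /sphere/= enormZ ger0_norm ?invr_ge0 ?enorm_ge0//.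
by rewrite mulVf// enorm_eq0.
Qed.

Lemma sphereZ_inj (a b : R) x y : 0 < a -> 0 < b -> sphere x -> sphere y ->
  a *: x = b *: y -> x = y.
Proof.
move=> a0 b0 x1 y1 e; have ab : a = b.
  move/(congr1 enorm): (e); rewrite !enormZ x1 y1 !mulr1.
  by rewrite !gtr0_norm.
move: e; rewrite ab => /(congr1 ( *:%R b^-1)).
by rewrite !scalerA mulVf ?gt_eqF// !scale1r.
Qed.

Lemma closed_sphere : closed (@sphere R n).
Proof.
rewrite (_ : sphere = enorm @^-1` [set 1]); last by [].
apply: closed_comp => [x _|]; first exact: enorm_continuous.
exact: closed_eq.
Qed.

Lemma bounded_compact (B : set V) (M : R) : closed B ->
  (forall x, B x -> `|x| <= M) -> compact B.
Proof.
move=> cB BM; apply: bounded_closed_compact => //.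
exists M; split; first exact: num_real.
by move=> N MN x /BM/le_trans; apply; exact: ltW.
Qed.

Lemma compact_sphere : compact (@sphere R n).
Proof. exact: (bounded_compact closed_sphere normr_sphere). Qed.

Lemma compact_normr_bound (B : set V) : compact B ->
  exists2 M, 0 < M & forall x, B x -> `|x| <= M.
Proof.
move=> /compact_bounded /ex_strict_bound_gt0[M M0 BM].
by exists M => // x Bx; apply/ltW/BM.
Qed.

Section support.
Variables (P : set V) (cP : compact P) (P0 : P !=set0).

Lemma supp_fun_attained x : exists2 p, P p &
  dotp x p = supp_fun P x /\ forall q, P q -> dotp x q <= dotp x p.
Proof.
have [p] := @EVT_max_rV R n (dotp x) P P0 cP
  (continuous_subspaceT (@dotp_continuousr x)).
rewrite inE => Pp pmax; exists p => //; split; last first.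
  by move=> q Pq; apply: pmax; rewrite inE.
apply/esym; rewrite /supp_fun; apply/eqP; rewrite eq_le; apply/andP; split.
  apply: ge_sup; first by exists (dotp x p), p.
  by move=> _ [q Pq <-]; apply: pmax; rewrite inE.
apply: ub_le_sup; last by exists p.
by exists (dotp x p) => _ [q Pq <-]; apply: pmax; rewrite inE.
Qed.

Lemma supp_fun_ge x p : P p -> dotp x p <= supp_fun P x.
Proof. by move=> Pp; have [q _ [<-]] := supp_fun_attained x; apply. Qed.

Lemma supp_fun_le x c : (forall p, P p -> dotp x p <= c) -> supp_fun P x <= c.
Proof. by move=> xc; have [p Pp [<- _]] := supp_fun_attained x; exact: xc. Qed.

Lemma supp_funZ (t : R) x : 0 <= t -> supp_fun P (t *: x) = t * supp_fun P x.
Proof.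
move=> t0; apply/eqP; rewrite eq_le; apply/andP; split.
  apply: supp_fun_le => p Pp; rewrite dotpZl ler_wpM2l//; exact: supp_fun_ge.
have [p Pp [<- _]] := supp_fun_attained x.
by rewrite -dotpZl; exact: supp_fun_ge.
Qed.

Lemma supp_fun_lipschitz : exists2 C : R, 0 < C &
  forall x y, `|supp_fun P x - supp_fun P y| <= C * `|x - y|.
Proof.
have [M M0 PM] := compact_normr_bound cP.
(* The factor [n] is the price of bounding the scalar product by the maximum norm; adding 1 makes
   the constant positive. *)
exists (n%:R * M + 1) => [|x y].
  by rewrite ltr_wpDl// mulr_ge0// ltW.
have H u v : supp_fun P u - supp_fun P v <= (n%:R * M + 1) * `|u - v|.
  have [p Pp [<- _]] := supp_fun_attained u.
  rewrite (@le_trans _ _ (dotp (u - v) p))//.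
    by rewrite dotpBl lerB// supp_fun_ge.
  rewrite (le_trans (ler_norm _))// (le_trans (normr_dotp _ _))//.
  rewrite mulrAC ler_wpM2r// (@le_trans _ _ (n%:R * M))//.
    by rewrite ler_wpM2l// PM.
  by rewrite lerDl.
by rewrite ler_norml lerNl opprB H distrC H.
Qed.

Lemma supp_fun_continuous : continuous (supp_fun P).
Proof.
have [C C0 lipC] := supp_fun_lipschitz.
move=> x; apply/(@cvgrPdist_le _ _ _ (nbhs x) _ (supp_fun P)) => e e0.
apply/nbhs_ballP.
exists (e / C) => [|y]; first by rewrite /= divr_gt0.
rewrite -ball_normE /= ltr_pdivlMr// mulrC => /ltW.
exact: (le_trans (lipC _ _)).
Qed.

End support.
End Euclidean.

(** * Lebesgue outer measure *)

Section Lebesgue.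
Context {R : realType} {n : nat}.
Hypothesis n0 : (0 < n)%N.
Local Notation V := 'rV[R]_n.
Implicit Types (x y z a b : V) (A B U : set V).

Definition bvol a b : R := \prod_(i < n) Num.max (b ord0 i - a ord0 i) 0.

Lemma bvol_ge0 a b : 0 <= bvol a b.
Proof. by apply: prodr_ge0 => i _; rewrite le_max lexx orbT. Qed.

Lemma bvol_eq0 a b : cbox a b = set0 -> bvol a b = 0.
Proof.
move=> ab0; have [i ab] : exists i, b ord0 i < a ord0 i.
  apply: contrapT => /forallNP H.
  have : cbox a b a by move=> i; rewrite lexx leNgt; apply/negP/H.
  by rewrite ab0.
rewrite /bvol (bigD1 i)//= max_r ?mul0r//.
by rewrite subr_le0 ltW.
Qed.

(** A nonempty box determines its corners, so the infimum in [box_vol] runs over a single pair; an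
    empty one has an inverted side, which the truncation at 0 turns into a zero factor. *)
Lemma box_vol_cbox a b : box_vol (cbox a b) = (bvol a b)%:E.
Proof.
rewrite /box_vol; case: asboolP => [/bvol_eq0->//|/eqP/set0P[x abx]].
have ab i : a ord0 i <= b ord0 i.
  by have /andP[ax xb] := abx i; exact: (le_trans ax).
rewrite (_ : [set _ | _ in _] = [set (bvol a b)%:E]) ?ereal_inf1//.
apply/seteqP; split=> [_ [[a' b'] /= abE <-]|_ ->]; last by exists (a, b).
have a'a : cbox a' b' a by rewrite -abE => i; rewrite lexx/=.
have b'b : cbox a' b' b by rewrite -abE => i; rewrite lexx andbT.
have ab' i : a' ord0 i <= b' ord0 i.
  by have /andP[u v] := a'a i; exact: (le_trans u).
have aa' : cbox a b a' by rewrite abE => i; rewrite lexx/=.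
have bb' : cbox a b b' by rewrite abE => i; rewrite lexx andbT.
have -> : a' = a.
  apply/rowP => i; apply/eqP; rewrite eq_le.
  by have /andP[-> _] := aa' i; have /andP[-> _] := a'a i.
have -> // : b' = b.
apply/rowP => i; apply/eqP; rewrite eq_le.
by have /andP[_ ->] := bb' i; have /andP[_ ->] := b'b i.
Qed.

Lemma cbox_empty : exists a b, cbox a b = set0.
Proof.
exists 0, (const_mx (-1)); apply/seteqP; split => // x /(_ (Ordinal n0)).
by rewrite !mxE => /andP[x0 /(le_trans x0)]; rewrite lerNr oppr0 ler10.
Qed.

(** Only coverings by boxes matter: at a nonempty set that is not a box, [box_vol] is an infimum
    over the empty set, hence infinite, and the empty set is itself a box by [cbox_empty]. *)
Lemma lebesgue_outer_ge A (y : \bar R) :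
  (forall a b : nat -> V, A `<=` \bigcup_k cbox (a k) (b k) ->
    (y <= \sum_(k <oo) (bvol (a k) (b k))%:E)%E) ->
  (y <= lebesgue_outer A)%E.
Proof.
move=> H; apply: le_ereal_inf_tmp => _ [F [_ AF] <-].
have [Fbox|/existsNP[k Fk]] := pselect (forall k, exists ab, F k = cbox ab.1 ab.2).
  have [ab FE] := choice Fbox.
  rewrite (eq_eseriesr (g := fun k => (bvol (ab k).1 (ab k).2)%:E)); last first.
    by move=> k _; rewrite FE box_vol_cbox.
  by apply: (H (fun k => (ab k).1) (fun k => (ab k).2)) => x /AF[k _];
    rewrite FE => ?; exists k.
rewrite (@eseries_pinfty _ _ _ k) ?leey//.
  by move=> i _; rewrite gt_eqF// (lt_le_trans _ (box_vol_ge0 _)).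
rewrite /box_vol; case: asboolP => [Fk0|_].
  exfalso; apply: Fk; have [a [b ab0]] := cbox_empty.
  by exists (a, b); rewrite Fk0 ab0.
rewrite (_ : [set _ | _ in _] = set0) ?ereal_inf0//.
by apply/seteqP; split => // _ [ab /= FE _]; apply: Fk; exists ab.
Qed.

Lemma lebesgue_outer_le A (a b : nat -> V) :
  A `<=` \bigcup_k cbox (a k) (b k) ->
  (lebesgue_outer A <= \sum_(k <oo) (bvol (a k) (b k))%:E)%E.
Proof.
move=> Aab; apply: ereal_inf_lbound; exists (fun k => cbox (a k) (b k)).
  split => // k; apply: sub_sigma_algebra; by exists (a k), (b k).
by apply: eq_eseriesr => k _; rewrite box_vol_cbox.
Qed.

Lemma lebesgue_outer_cbox a b : (lebesgue_outer (cbox a b) <= (bvol a b)%:E)%E.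
Proof.
have [a0 [b0 ab0]] := cbox_empty.
pose u k := if k is 0%N then a else a0.
pose v k := if k is 0%N then b else b0.
rewrite (le_trans (@lebesgue_outer_le _ u v _))//; first by move=> x ?; exists 0%N.
rewrite nneseries_recl//; last by move=> k _; rewrite lee_fin bvol_ge0.
rewrite eseries_cond eseries0 ?adde0// => -[|k]//= _ _.
by rewrite bvol_eq0.
Qed.

Lemma lebesgue_outer_translate_le A v :
  (lebesgue_outer [set (x + v)%R | x in A] <= lebesgue_outer A)%E.
Proof.
apply: lebesgue_outer_ge => a b Aab.
rewrite (le_trans (@lebesgue_outer_le _ (fun k => a k + v) (fun k => b k + v) _))//.
  move=> _ [x /Aab[k _ xk] <-]; exists k => // i.
  by rewrite !mxE !lerD2r.
apply: lee_nneseries => [k _ _|k _]; first by rewrite lee_fin bvol_ge0.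
rewrite lee_fin /bvol le_eqVlt; apply/orP; left; apply/eqP.
by apply: eq_bigr => i _; rewrite !mxE; congr Num.max; ring.
Qed.

Lemma lebesgue_outer_translate A v :
  lebesgue_outer [set x + v | x in A] = lebesgue_outer A.
Proof.
apply/eqP; rewrite eq_le lebesgue_outer_translate_le/=.
rewrite -[in leLHS](_ : [set (x - v)%R | x in [set (x + v)%R | x in A]] = A).
  exact: lebesgue_outer_translate_le.
apply/seteqP; split=> [_ [_ [x Ax <-] <-]|x Ax]; first by rewrite addrK.
by exists (x + v); [exists x | rewrite addrK].
Qed.

Lemma lebesgue_outer_scale_le (t : R) A : 0 < t ->
  (lebesgue_outer [set (t *: x)%R | x in A] <= (t ^+ n)%:E * lebesgue_outer A)%E.
Proof.
move=> t0; rewrite -lee_pdivrMl ?exprn_gt0//.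
apply: lebesgue_outer_ge => a b Aab.
rewrite lee_pdivrMl ?exprn_gt0// -nneseriesZl; last first.
  by move=> k _; rewrite lee_fin bvol_ge0.
rewrite (le_trans (@lebesgue_outer_le _ (fun k => t *: a k) (fun k => t *: b k) _))//.
  move=> _ [x /Aab[k _ xk] <-]; exists k => // i.
  by rewrite !mxE !ler_pM2l.
apply: lee_nneseries => [k _ _|k _]; first by rewrite lee_fin bvol_ge0.
rewrite -EFinM lee_fin /bvol le_eqVlt; apply/orP; left; apply/eqP.
under eq_bigr => i _ do rewrite !mxE -mulrBr -[X in Num.max _ X](mulr0 t)
  -maxr_pMr ?ltW//.
by rewrite big_split/= prodr_const card_ord.
Qed.

Lemma lebesgue_outer_scale (t : R) A : 0 < t ->
  lebesgue_outer [set t *: x | x in A] = ((t ^+ n)%:E * lebesgue_outer A)%E.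
Proof.
move=> t0; apply/eqP; rewrite eq_le lebesgue_outer_scale_le//=.
rewrite -lee_pdivlMl ?exprn_gt0// -exprVn.
rewrite -[in leLHS](_ : [set (t^-1 *: x)%R | x in [set (t *: x)%R | x in A]] = A).
  by apply: lebesgue_outer_scale_le; rewrite invr_gt0.
have tK x : t^-1 *: (t *: x) = x by rewrite scalerA mulVf ?gt_eqF// scale1r.
apply/seteqP; split=> [_ [_ [x Ax <-] <-]|x Ax]; first by rewrite tK.
by exists (t *: x); [exists x | rewrite tK].
Qed.

Lemma lebesgue_outer_bounded A (M : R) : (forall x, A x -> `|x| <= M) ->
  (lebesgue_outer A < +oo)%E.
Proof.
move=> AM; apply: le_lt_trans (ltry (bvol (const_mx (- M)) (const_mx M))).
apply: le_trans (lebesgue_outer_cbox _ _); apply: le_lebesgue_outer => x Ax i.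
by rewrite !mxE -ler_norml (le_trans (normr_coord _ _))// AM.
Qed.

HB.instance Definition _ := isOuterMeasure.Build R V lebesgue_outer
  lebesgue_outer0 lebesgue_outer_ge0 le_lebesgue_outer
  lebesgue_outer_sigma_subadditive.

(** The hyperplane $x_i=c$ cuts each covering box into two boxes, one per side, whose volumes add up
    exactly, so a covering of [X] splits at no cost. *)
Lemma caratheodory_halfspace i (c : R) :
  lebesgue_outer.-caratheodory [set x : V | x ord0 i <= c].
Proof.
apply: le_caratheodory_measurable => X; set H := [set x | _].
apply: lebesgue_outer_ge => a b Xab.
pose a' k : V := \row_j if j == i then Num.max (a k ord0 j) c else a k ord0 j.
pose b' k : V := \row_j if j == i then Num.min (b k ord0 j) c else b k ord0 j.
have -> : (\sum_(k <oo) (bvol (a k) (b k))%:E =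
    \sum_(k <oo) (bvol (a k) (b' k))%:E + \sum_(k <oo) (bvol (a' k) (b k))%:E)%E.
  rewrite -nneseriesD; try by move=> k _ _; rewrite lee_fin bvol_ge0.
  apply: eq_eseriesr => k _; rewrite -EFinD; congr EFin.
  rewrite /bvol !(bigD1 (P := xpredT) i)//=.
  under [in RHS]eq_bigr => j /negbTE ji do rewrite mxE ji.
  under [X in _ = _ + _ * X]eq_bigr => j /negbTE ji do rewrite mxE ji.
  rewrite !mxE eqxx -mulrDl; congr (_ * _).
  rewrite /Num.max /Num.min; do !case: ifPn; rewrite -?leNgt => *; lra.
apply: leeD; apply: lebesgue_outer_le => x [/Xab[k _ xk]] xc; exists k => // j.
  rewrite !mxE; have := xk j; case: ifPn => // /eqP -> /andP[-> xb].
  by rewrite /= le_min xb.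
rewrite !mxE; have := xk j; case: ifPn => // /eqP -> /andP[xb ->].
rewrite andbT ge_max xb /= ltW// ltNge; exact/negP.
Qed.

Local Notation lambda := (lebesgue_outer : {outer_measure set V -> \bar R}).

(** Half-open cubes are finite intersections of half-spaces $x_i\le c$ and complements of such. *)
Lemma caratheodory_hbox (q : V) (r : R) :
  lebesgue_outer.-caratheodory
    [set x : V | forall i, q ord0 i - r < x ord0 i <= q ord0 i + r].
Proof.
pose L := caratheodory_type lambda.
rewrite (_ : mkset _ = \bigcap_(i in [set: 'I_n])
    ([set x : V | x ord0 i <= q ord0 i + r] `&`
     ~` [set x : V | x ord0 i <= q ord0 i - r])); last first.
  apply/seteqP; split=> x /= H i.
    by have /andP[H1 H2] := H i; split => //=; apply/negP; rewrite -ltNge.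
  by have [/= -> /negP] := H i I; rewrite -ltNge => ->.
rewrite -[X in _ X]setCK setC_bigcap; apply: (@measurableC _ L).
apply: (@countable_bigcupT_measurable _ L) => [|i]; first exact: countableP.
apply: measurableC; apply: measurableI; last apply: measurableC;
  exact: caratheodory_halfspace.
Qed.

(** An open set is the union of the countably many half-open cubes with rational centre and
    half-side $1/(k+1)$ that it contains. *)
Lemma caratheodory_open U : open U -> lebesgue_outer.-caratheodory U.
Proof.
move=> oU; pose L := caratheodory_type lambda.
pose hb (qk : 'rV[rat]_n * nat) : set V := [set x : V | forall i,
  ratr (qk.1 ord0 i) - qk.2.+1%:R^-1 < x ord0 i <= ratr (qk.1 ord0 i) + qk.2.+1%:R^-1].
pose F qk : set L := if `[< hb qk `<=` U >] then hb qk else set0.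
rewrite (_ : U = \bigcup_qk F qk).
  apply: (@countable_bigcupT_measurable _ L) => [|qk]; first exact: countableP.
  rewrite /F; case: asboolP => _ //.
  have := caratheodory_hbox (map_mx ratr qk.1) qk.2.+1%:R^-1.
  congr (_ _); apply/seteqP; split=> x /= H i; have := H i; by rewrite mxE.
apply/seteqP; split=> [x Ux|x [qk _]]; last first.
  by rewrite /F; case: asboolP => // + xq; apply.
have /nbhs_ballP[e /= e0 xeU] : nbhs x U by apply: open_nbhs_nbhs.
(* Two points of a cube of half-side $r$ are at distance at most $2r$, hence the bound by
   [e / 2]. *)
have [k ke] : exists k, k.+1%:R^-1 < e / 2.
  have e20 : 0 < e / 2 by rewrite divr_gt0.
  by have [k] := ltr_add_invr e20; rewrite add0r; exists k.
have /choice[q qP] : forall i, exists q : rat,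
    x ord0 i - k.+1%:R^-1 < ratr q < x ord0 i + k.+1%:R^-1.
  move=> i; have [|q] := @rat_in_itvoo R (x ord0 i - k.+1%:R^-1) (x ord0 i + k.+1%:R^-1).
    by rewrite ltrBlDr -addrA ltrDl addr_gt0// invr_gt0.
  by rewrite in_itv/=; exists q.
exists (\row_i q i, k) => //; rewrite /F asboolT => [i|y yq] /=.
  rewrite mxE; have := qP i; set r := _^-1 => /andP[q1 q2].
  by apply/andP; split=> /=; lra.
apply: xeU; split => // i0 i; rewrite (ord1 i0) /ball /= ltr_norml.
have := yq i; rewrite /= mxE; have := qP i; move: ke.
by set r := _^-1 => re /andP[q1 q2] /andP[y1 y2]; apply/andP; split; lra.
Qed.

(** Without the existential quantifiers, membership depends on [A] only through the direction of
    [y], so cones visibly commute with Boolean operations inside the punctured unit ball. *)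
Lemma coneE A : cone A =
  [set y | [/\ y != 0, enorm y <= 1 & A ((enorm y)^-1 *: y)]].
Proof.
apply/seteqP; split=> y.
  move=> [t [x [/andP[t0 t1] Ax Sx ->]]] /=.
  rewrite enormZ Sx mulr1 gtr0_norm//; split => //.
    by rewrite scaler_eq0 gt_eqF//= sphere_neq0.
  by rewrite scalerA mulVf ?gt_eqF// scale1r.
move=> /= [y0 y1 Ay]; exists (enorm y), ((enorm y)^-1 *: y); split => //.
- by rewrite enorm_gt0 y0.
- exact: sphere_normalize.
- by rewrite scalerA mulfV ?enorm_eq0// scale1r.
Qed.

(** Splitting [X] by [A] amounts to splitting the test set [cone X] by [cone A]. *)
Lemma caratheodory_cone A : lebesgue_outer.-caratheodory (cone A) ->
  sph_outer.-caratheodory A.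
Proof.
move=> mA X; have := mA (cone X); rewrite /sph_outer => ->.
have -> : cone X `&` cone A = cone (X `&` A).
  by rewrite !coneE; apply/seteqP; split=> y /=; [move=> [[? ? ?] [? ? ?]]|case=> ? ? []].
have -> : cone X `&` ~` cone A = cone (X `&` ~` A).
  rewrite !coneE; apply/seteqP; split=> y /=.
    by move=> [[y0 y1 Xy] H]; split => //; split => // Ay; apply: H.
  by move=> [y0 y1 [Xy Ay]]; split => // -[].
by rewrite ge0_muleDr// lebesgue_outer_ge0.
Qed.

(** Normalization is continuous off the origin, so the cone over an open set is the closed unit ball
    intersected with an open set. *)
Lemma sph_caratheodory_open U : open U -> sph_outer.-caratheodory U.
Proof.
move=> oU; apply: caratheodory_cone; rewrite coneE.
pose L := caratheodory_type lambda.
rewrite (_ : mkset _ = [set y | enorm y <= 1] `&`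
  [set y | y != 0 /\ U ((enorm y)^-1 *: y)]); last first.
  by apply/seteqP; split=> y /= []; [move=> ? ? ?|move=> ? []].
apply: (@measurableI _ L).
  rewrite -[X in _ X]setCK; apply: measurableC; apply: caratheodory_open.
  apply: closed_openC; rewrite (_ : mkset _ = enorm @^-1` [set r | r <= 1])//.
  apply: closed_comp => [x _|]; [exact: enorm_continuous|exact: closed_le].
apply: caratheodory_open; rewrite openE => y [y0 Uy].
apply: filterI.
  have : open (~` [set (0 : V)]).
    by apply: closed_openC; apply: accessible_closed_set1; exact: hausdorff_accessible.
  rewrite openE => /(_ y) H; apply: filterS (H _); last exact/eqP.
  by move=> z /eqP.
have cy : {for y, continuous (fun y : V => (enorm y)^-1 *: y)}.
  apply: (@cvgZ _ _ _ (nbhs y) _ (fun y => (enorm y)^-1) id) => //.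
  by apply: cvgV; [rewrite enorm_eq0 | exact: enorm_continuous].
by apply: cy; move: oU; rewrite openE; exact.
Qed.

End Lebesgue.

(** * Points with several maximizers *)

Lemma outer_measure_null_bigcup (R : realType) (T : Type) (I : countType)
    (mu : {outer_measure set T -> \bar R}) (F : I -> set T) :
  (forall i, mu (F i) = 0%E) -> mu (\bigcup_i F i) = 0%E.
Proof.
move=> F0; apply/eqP; rewrite eq_le outer_measure_ge0 andbT.
pose G k := if unpickle k is Some i then F i else set0.
apply: (@le_trans _ _ (mu (\bigcup_k G k))).
  apply: le_outer_measure => x [i _ Fx]; exists (pickle i) => //.
  by rewrite /G pickleK.
rewrite (le_trans (outer_measure_sigma_subadditive mu G))// eseries0// => k _ _.
by rewrite /G; case: unpickle => [i|]; rewrite ?outer_measure0.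
Qed.

Section NonuniqueMaximizers.
Context {R : realType} {n : nat}.
Hypothesis n0 : (0 < n)%N.
Local Notation V := 'rV[R]_n.
Implicit Types (x y z p q : V) (Q : set V).
Local Notation lambda := (lebesgue_outer : {outer_measure set V -> \bar R}).
Local Notation L := (caratheodory_type lambda).

(** For nonempty compact [Q] these are the points where the convex function [supp_fun Q] is not
    differentiable. *)
Definition nonuniq Q : set V := [set x | exists p q, [/\ Q p, Q q, p <> q,
  dotp x p = supp_fun Q x & dotp x q = supp_fun Q x]].

Variables (Q : set V) (cQ : compact Q) (Q0 : Q !=set0).

(** Some maximizer over [Q] lies in [Q'] exactly when the two support functions agree at [x], and
    both are continuous. *)
Lemma closed_maximizer_in (Q' : set V) : Q' `<=` Q -> compact Q' ->
  closed [set x | exists2 p, Q' p & dotp x p = supp_fun Q x].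
Proof.
move=> Q'Q cQ'; have [->|/set0P Q'0] := eqVneq Q' set0.
  rewrite (_ : mkset _ = set0); first exact: closed0.
  by apply/seteqP; split => // x [].
rewrite (_ : mkset _ = (supp_fun Q' \- supp_fun Q) @^-1` [set 0]); last first.
  apply/seteqP; split=> x /=.
    move=> [p Q'p xp]; apply/eqP; rewrite subr_eq0 eq_le -{2}xp.
    rewrite supp_fun_ge// andbT; apply: supp_fun_le => // q /Q'Q.
    exact: supp_fun_ge.
  have [p Q'p [xp _]] := supp_fun_attained cQ' Q'0 x.
  by move=> /eqP; rewrite subr_eq0 => /eqP <-; exists p.
apply: closed_comp; last exact: closed_eq.
move=> x _; apply: (@cvgB _ _ _ (nbhs x) _ (supp_fun Q') (supp_fun Q));
  exact: supp_fun_continuous.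
Qed.

(** The inequalities are weak to make the set closed; strict separation comes from [a < b]. *)
Definition coord_split i (a b : R) : set V :=
  [set x | exists2 p, Q p /\ p ord0 i <= a & dotp x p = supp_fun Q x] `&`
  [set x | exists2 p, Q p /\ b <= p ord0 i & dotp x p = supp_fun Q x].

Lemma closed_coord_split i a b : closed (coord_split i a b).
Proof.
have cc c : closed [set p : V | p ord0 i <= c].
  rewrite (_ : mkset _ = (fun p : V => p ord0 i) @^-1` [set r | r <= c])//.
  apply: closed_comp; [by move=> x _; exact: coord_continuous|exact: closed_le].
have cc' c : closed [set p : V | c <= p ord0 i].
  rewrite (_ : mkset _ = (fun p : V => p ord0 i) @^-1` [set r | c <= r])//.
  apply: closed_comp; [by move=> x _; exact: coord_continuous|exact: closed_ge].
apply: closedI.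
  apply: (@closed_maximizer_in (Q `&` [set p | p ord0 i <= a])).
    by move=> ? [].
  exact: compact_closedI cQ (cc a).
apply: (@closed_maximizer_in (Q `&` [set p | b <= p ord0 i])).
  by move=> ? [].
exact: compact_closedI cQ (cc' b).
Qed.

(* Monotonicity of the maximizer along a line parallel to the i-th axis. *)
Lemma coord_split_line i a b x (t : R) : a < b -> 0 < t ->
  coord_split i a b x -> coord_split i a b (x + t *: delta_mx ord0 i) -> False.
Proof.
move=> ab t0 [_ [q [Qq bq] xq]] [[p [Qp pa] xp] _].
have := supp_fun_ge cQ Q0 x Qp.
have := supp_fun_ge cQ Q0 (x + t *: delta_mx ord0 i) Qq.
rewrite -xq -xp !dotpDl !dotpZl !dotp_delta => H1 H2.
have : t * q ord0 i <= t * p ord0 i by lra.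
by rewrite ler_pM2l// => qp; lra.
Qed.

Lemma coord_split_null i a b (M : R) : a < b ->
  lebesgue_outer (coord_split i a b `&` [set x | `|x| <= M]) = 0%E.
Proof.
move=> ab; set A := _ `&` _.
have cA : closed A.
  apply: closedI; first exact: closed_coord_split.
  rewrite (_ : mkset _ = (fun x : V => `|x|) @^-1` [set r | r <= M])//.
  apply: closed_comp; [by move=> x _; exact: norm_continuous|exact: closed_le].
pose e : V := delta_mx ord0 i.
(* The shifts $1/(k+1)$ are pairwise distinct and at most 1, so the copies are disjoint and stay in
   one ball. *)
pose F k : set L := [set x + k.+1%:R^-1 *: e | x in A].
have mF k : measurable (F k).
  rewrite -[X in _ X]setCK; apply: measurableC; apply: caratheodory_open => //.
  apply: closed_openC.
  rewrite (_ : F k = (fun x => x - k.+1%:R^-1 *: e) @^-1` A); last first.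
    apply/seteqP; split=> [_ [x Ax <-]|x Ax] /=; first by rewrite addrK.
    by exists (x - k.+1%:R^-1 *: e) => //; rewrite subrK.
  apply: closed_comp => // x _.
  by apply: (@cvgB _ _ _ (nbhs x) _ id) => //; exact: cvg_cst.
have FM : (lebesgue_outer (\bigcup_k F k) < +oo)%E.
  apply: (@lebesgue_outer_bounded _ _ n0 _ (M + `|e|)) => _ [k _ [x [_ xM] <-]].
  rewrite (le_trans (ler_normD _ _))// lerD// normrZ ler_piMl// ger0_norm//.
  by rewrite invf_le1// ler1n.
have tF : trivIset setT F.
  apply/trivIsetP => j k _ _ jk; apply/seteqP; split=> // _ [[x [Ex _] <-]].
  move=> [y [Ey _] /esym xy].
  have ne : k.+1%:R^-1 - j.+1%:R^-1 != 0 :> R.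
    by rewrite subr_eq0 (inj_eq invr_inj) eqr_nat eqSS eq_sym.
  case: (ltgtP 0 (k.+1%:R^-1 - j.+1%:R^-1 : R)) => [s0|s0|s0].
  - apply: (coord_split_line ab s0 Ey); rewrite (_ : _ + _ = x)//.
    by rewrite scalerBl addrA -xy addrK.
  - have s0' : 0 < j.+1%:R^-1 - k.+1%:R^-1 :> R by rewrite -opprB oppr_gt0.
    apply: (coord_split_line ab s0' Ex); rewrite (_ : _ + _ = y)//.
    by rewrite scalerBl addrA xy addrK.
  - by move: ne; rewrite -s0 eqxx.
have FA k : lebesgue_outer (F k) = lebesgue_outer A.
  exact: lebesgue_outer_translate.
have A0 : (lebesgue_outer A < +oo)%E.
  by apply: (@lebesgue_outer_bounded _ _ n0 _ M) => x [].
have Afin : lebesgue_outer A \is a fin_num.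
  by rewrite ge0_fin_numE// lebesgue_outer_ge0.
have Ffin : lebesgue_outer (\bigcup_k F k) \is a fin_num.
  by rewrite ge0_fin_numE// lebesgue_outer_ge0.
have Nle N : fine (lebesgue_outer A) *+ N <= fine (lebesgue_outer (\bigcup_k F k)).
  rewrite -lee_fin [leRHS]fineK//.
  have -> : lebesgue_outer (\bigcup_k F k) = (\sum_(k <oo) lebesgue_outer (F k))%E.
    exact: (@measure_semi_bigcup _ _ _ lambda F mF tF (bigcupT_measurable _ mF)).
  rewrite (le_trans _ (@nneseries_lim_ge _ _ xpredT 0 N _))//; last first.
    by move=> k _ _; exact: lebesgue_outer_ge0.
  rewrite big_mkord (eq_bigr (fun=> (fine (lebesgue_outer A))%:E)); last first.
    by move=> k _; rewrite /= fineK// -(FA k).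
  by rewrite sumEFin sumr_const card_ord.
have r0 : 0 <= fine (lebesgue_outer A) by rewrite fine_ge0// lebesgue_outer_ge0.
rewrite -(fineK Afin); congr EFin; apply/eqP; rewrite eq_le r0 andbT leNgt.
apply/negP => rpos.
set S := fine (lebesgue_outer (\bigcup_k _)) in Nle.
have S0 : 0 <= S by have := Nle 0%N; rewrite mulr0n.
have := Nle (Num.bound (S / fine (lebesgue_outer A))); rewrite leNgt => /negP; apply.
rewrite -[X in _ < X]mulr_natr -ltr_pdivrMl// mulrC.
by apply: archi_boundP; rewrite divr_ge0.
Qed.

Lemma nonuniq_null (M : R) :
  lebesgue_outer (nonuniq Q `&` [set x | `|x| <= M]) = 0%E.
Proof.
pose F (k : 'I_n * (rat * rat)) : set V :=
  if ratr k.2.1 < ratr k.2.2 :> R then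
    coord_split k.1 (ratr k.2.1) (ratr k.2.2) `&` [set x | `|x| <= M] else set0.
apply/eqP; rewrite eq_le lebesgue_outer_ge0 andbT.
rewrite -(@outer_measure_null_bigcup _ _ _ lambda F); last first.
  move=> k; rewrite /F; case: ifPn => // kk; first exact: coord_split_null.
apply: le_lebesgue_outer => x [[p [q [Qp Qq pq xp xq]]] xM].
wlog [i pqi] : p q Qp Qq pq xp xq / exists i, p ord0 i < q ord0 i.
  move=> H; have [i pqi] : exists i, p ord0 i != q ord0 i.
    apply: contrapT => /forallNP H'; apply: pq; apply/rowP => i.
    by have /negP := H' i; rewrite negbK => /eqP.
  move: pqi; rewrite neq_lt => /orP[pqi|qpi].
    by apply: (H p q) => //; exists i.
  by apply: (H q p) => //; [exact/nesym|exists i].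
have [a] := rat_in_itvoo pqi; rewrite in_itv/= => /andP[pa aq].
have [b] := rat_in_itvoo aq; rewrite in_itv/= => /andP[ab bq].
exists (i, (a, b)) => //; rewrite /F /= ab; split => //; split.
  by exists p => //; split => //; exact: ltW.
by exists q => //; split => //; exact: ltW.
Qed.

End NonuniqueMaximizers.

(** * Bisection and finite measures *)

(** Halving an interval halves the factor [y - x], while the values of [tau] on the halves add up
    again; each bisection thus improves the bound on the whole interval by a factor 2. *)
Lemma additive_interval_eq0 (R : realType) (Phi tau : R -> R -> R) (a b : R) :
  a <= b ->
  (forall x y z, a <= x -> x <= y -> y <= z -> z <= b ->
    Phi x z = Phi x y + Phi y z) ->
  (forall x y z, a <= x -> x <= y -> y <= z -> z <= b ->
    tau x z = tau x y + tau y z) ->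
  (forall x y, a <= x -> x <= y -> y <= b -> `|Phi x y| <= (y - x) * tau x y) ->
  Phi a b = 0.
Proof.
move=> ab PhiD tauD Phitau.
have H k : forall x y, a <= x -> x <= y -> y <= b ->
    `|Phi x y| <= (y - x) * tau x y / 2 ^+ k.
  elim: k => [|k IH] x y ax xy yb; first by rewrite expr0 divr1 Phitau.
  pose z := (x + y) / 2.
  have xz : x <= z by rewrite /z; lra.
  have zy : z <= y by rewrite /z; lra.
  rewrite (PhiD x z y)// (tauD x z y)// (le_trans (ler_normD _ _))//.
  have Hx := IH x z ax xz (le_trans zy yb).
  have Hy := IH z y (le_trans ax xz) zy yb.
  rewrite (le_trans (lerD Hx Hy))// exprS invfM.
  by rewrite le_eqVlt /z; apply/orP; left; apply/eqP; field.
apply/eqP; rewrite -normr_le0; apply/ler_addgt0Pr => e e0; rewrite add0r.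
pose c := (b - a) * tau a b.
have c0 : 0 <= c by apply: le_trans (Phitau a b _ _ _).
(* With $k$ = [Num.bound (c / e)], $c/e<k\le 2^k$, so the bound $c/2^k$ is below [e]. *)
have := H (Num.bound (c / e)) a b (lexx _) ab (lexx _).
move=> /le_trans; apply; rewrite -/c ler_pdivrMr ?exprn_gt0//.
rewrite mulrC -ler_pdivrMr// ltW//.
apply: (@lt_le_trans _ _ (Num.bound (c / e))%:R).
  by apply: archi_boundP; rewrite divr_ge0// ltW.
by rewrite -natrX ler_nat ltnW// ltn_expl.
Qed.

Lemma exprn_lipschitz (R : realType) (n : nat) (M : R) : 0 <= M ->
  exists2 C : R, 0 <= C & forall a b : R, 0 <= a -> a <= b -> b <= M ->
    b ^+ n - a ^+ n <= C * (b - a).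
Proof.
move=> M0; elim: n => [|n [C C0 IH]].
  by exists 0 => // a b _ _ _; rewrite !expr0 subrr mul0r.
exists (M * C + M ^+ n) => [|a b a0 ab bM].
  by rewrite addr_ge0 ?mulr_ge0 ?exprn_ge0.
rewrite (_ : _ - _ = b * (b ^+ n - a ^+ n) + a ^+ n * (b - a)); last first.
  by rewrite !exprS; ring.
rewrite mulrDl -mulrA; apply: lerD.
  apply: ler_pM => //; [exact: le_trans a0 ab| |exact: IH].
  by rewrite subr_ge0 lerXn2r ?nnegrE//; exact: le_trans a0 ab.
rewrite ler_wpM2r ?subr_ge0// lerXn2r ?nnegrE//; exact: le_trans ab bM.
Qed.

(** * Integrals over sets of finite measure *)

Section FiniteMeasure.
Context d (T : measurableType d) (R : realType) (mu : {measure set T -> \bar R}).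
Implicit Types (D : set T) (f : T -> R).

Lemma bounded_integrable D f (M : R) : measurable D -> (mu D < +oo)%E ->
  measurable_fun D f -> (forall x, D x -> `|f x| <= M) ->
  mu.-integrable D (EFin \o f).
Proof.
move=> mD muD mf fM; apply: measurable_bounded_integrable => //.
exists M; split; first exact: num_real.
by move=> N MN x Dx; exact: le_trans (fM x Dx) (ltW MN).
Qed.

Lemma Rintegral_between D f (a b : R) : measurable D -> (mu D < +oo)%E ->
  mu.-integrable D (EFin \o f) -> (forall x, D x -> a <= f x <= b) ->
  a * fine (mu D) <= Rintegral mu D f <= b * fine (mu D).
Proof.
move=> mD muD fi fab; rewrite -!Rintegral_cst//.
have ci (c : R) : mu.-integrable D (EFin \o cst c).
  by apply: (@bounded_integrable _ _ `|c|).
apply/andP; split.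
  by apply: le_Rintegral => //; [exact: ci | move=> x /fab /andP[]].
by apply: le_Rintegral => //; [exact: ci | move=> x /fab /andP[]].
Qed.

Lemma fine_measureU D1 D2 : measurable D1 -> measurable D2 ->
  (mu D1 < +oo)%E -> (mu D2 < +oo)%E -> [disjoint D1 & D2] ->
  fine (mu (D1 `|` D2)) = fine (mu D1) + fine (mu D2).
Proof.
move=> mD1 mD2 D1oo D2oo /eqP D12.
by rewrite measureU// fineD// ge0_fin_numE.
Qed.

End FiniteMeasure.

(** * Measurability of relatively continuous functions *)

Section WithinContinuous.

Lemma within_continuous_preimage (X Y : topologicalType) (E : set X) (f : X -> Y)
    (U : set Y) : {within E, continuous f} -> open U ->
  exists2 W, open W & E `&` f @^-1` U = E `&` W.
Proof.
move=> cf oU.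
have /open_subspaceP[W oW WE] := (@continuousP (subspace E) Y f).1 cf U oU.
by exists W; rewrite // setIC -WE setIC.
Qed.

Context d (T : measurableType d) (X : topologicalType) (i : T -> X).
Hypothesis mi : forall U, open U -> measurable (i @^-1` U).

(** In every application [i] is the identity of the row vectors, from a type carrying a Caratheodory
    or Borel sigma-algebra to the one carrying the topology. *)
Lemma within_continuous_measurable (R : realType) (E : set X) (f : X -> R) :
  measurable (i @^-1` E) -> {within E, continuous f} ->
  measurable_fun (i @^-1` E) (f \o i).
Proof.
move=> mE cf; apply: (measurability _ (RGenOInfty.measurableE R)).
move=> _ [_ [x ->] <-].
have [W oW EW] := within_continuous_preimage cf (@open_gt _ x).
rewrite (_ : _ `&` _ = i @^-1` E `&` i @^-1` W).
  by apply: measurableI => //; exact: mi.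
rewrite -preimage_setI -EW; apply/seteqP; split=> t /=.
  by rewrite in_itv/= andbT.
by rewrite in_itv/= andbT.
Qed.

End WithinContinuous.

(** * Polar coordinates *)

Section SphericalMeasure.
Context {R : realType} {n : nat}.
Hypothesis n0 : (0 < n)%N.
Local Notation V := 'rV[R]_n.
Local Notation S := (sphere : set (@SphType R n)).

Lemma sph_measurable_open (U : set V) : open U -> measurable (U : set (@SphType R n)).
Proof. exact: sph_caratheodory_open. Qed.

Lemma sph_measurable_closed (A : set V) : closed A ->
  measurable (A : set (@SphType R n)).
Proof.
move=> cA; rewrite -(setCK (A : set (@SphType R n))); apply: measurableC.
exact: (sph_measurable_open (closed_openC cA)).
Qed.

Lemma sph_measurable_sphere : measurable S.
Proof. exact: (sph_measurable_closed closed_sphere). Qed.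

Lemma cone_enorm (A : set V) y : cone A y -> enorm y <= 1.
Proof. by rewrite coneE => -[]. Qed.

Lemma lebesgue_outer_cone_lty (A : set V) : (lebesgue_outer (cone A) < +oo)%E.
Proof.
apply: (@lebesgue_outer_bounded _ _ n0 _ 1) => x /cone_enorm.
exact: le_trans (normr_le_enorm x).
Qed.

Lemma lebesgue_outer_cone_fin (A : set V) : lebesgue_outer (cone A) \is a fin_num.
Proof. by rewrite ge0_fin_numE ?lebesgue_outer_ge0// lebesgue_outer_cone_lty. Qed.

Lemma fine_sph_measure (A : set (@SphType R n)) :
  fine (sph_measure A) = n%:R * fine (lebesgue_outer (cone A)).
Proof.
have -> : sph_measure A = (n%:R%:E * lebesgue_outer (cone A))%E by [].
by rewrite fineM ?lebesgue_outer_cone_fin.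
Qed.

Lemma sph_measure_lty (A : set (@SphType R n)) : (sph_measure A < +oo)%E.
Proof.
have -> : sph_measure A = (n%:R%:E * lebesgue_outer (cone A))%E by [].
by rewrite -(fineK (lebesgue_outer_cone_fin A)) -EFinM ltry.
Qed.

(** Completeness of Caratheodory's construction. It makes the set of singular directions measurable,
    and every function measurable on it. *)
Lemma sph_measure_null_measurable (A : set (@SphType R n)) :
  sph_measure A = 0%E -> measurable A.
Proof.
move=> A0; apply: le_caratheodory_measurable => X.
have XA : sph_om (X `&` A) = 0%E.
  apply/eqP; rewrite eq_le outer_measure_ge0 andbT -[leRHS]A0.
  by apply: (@le_outer_measure _ _ sph_om) => x [].
by rewrite [X in (X + _)%E]XA add0e; apply: (@le_outer_measure _ _ sph_om) => x [].
Qed.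

Section Polar.
Variable m : V -> R.
Hypotheses (mc : continuous m) (mZ : forall t x, 0 <= t -> m (t *: x) = t * m x).
Hypothesis mpos : forall x, x != 0 -> 0 < m x.

Lemma gauge_bounds : exists c C : R,
  [/\ 0 < c, c <= C & forall x, sphere x -> c <= m x <= C].
Proof.
have [S0|/set0P S0] := eqVneq (@sphere R n) set0.
  by exists 1, 1; rewrite S0.
have cm : {within sphere, continuous m} by exact: continuous_subspaceT.
have [x xS xmin] := EVT_min_rV S0 (@compact_sphere R n) cm.
have [y yS ymax] := EVT_max_rV S0 (@compact_sphere R n) cm.
exists (m x), (m y); split; last by move=> z zS; rewrite xmin ?ymax ?inE.
  by apply: mpos; move: xS; rewrite inE; exact: sphere_neq0.
exact: xmin.
Qed.

Lemma gauge_enorm x : m x = enorm x * m ((enorm x)^-1 *: x).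
Proof.
rewrite mZ ?invr_ge0 ?enorm_ge0//.
have [->|x0] := eqVneq x 0.
  by rewrite enorm0 mul0r -(scale0r (0 : V)) mZ// mul0r.
by rewrite mulrA divff ?mul1r// enorm_eq0.
Qed.

Lemma gauge_body_bounded : exists M : R, forall x, m x <= 1 -> `|x| <= M.
Proof.
have [c [C [c0 cC cm]]] := gauge_bounds.
exists c^-1 => x; have [->|x0] := eqVneq x 0.
  by move=> _; rewrite normr0 invr_ge0 ltW.
rewrite gauge_enorm => H; apply: (le_trans (normr_le_enorm x)).
rewrite -[leRHS]mul1r ler_pdivlMr//; apply: le_trans H.
rewrite ler_wpM2l ?enorm_ge0//.
by have /andP[] := cm _ (sphere_normalize x0).
Qed.

(** Level sets of the radial function $1/m$. Since [enorm y / m y] is its value at the direction of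
    [y], [W a b] is the part of the body over the directions in [A a b], without the origin. *)
Let A (a b : R) : set V := [set x | sphere x /\ a <= (m x)^-1 < b].
Let W (a b : R) : set V :=
  [set y | [/\ m y <= 1, y != 0 & a <= enorm y / m y < b]].

Let sinvm_cont : {within sphere, continuous (fun x => (m x)^-1)}.
Proof.
apply: continuous_in_subspaceT => x; rewrite inE => /sphere_neq0 x0.
have mx0 : m x != 0 by rewrite gt_eqF// mpos.
exact: (cvgV mx0 (@mc x)).
Qed.

Let measurable_sinvm : measurable_fun S (fun x => (m x)^-1).
Proof.
exact: (@within_continuous_measurable _ (@SphType R n) V id sph_measurable_open
  R sphere _ sph_measurable_sphere sinvm_cont).
Qed.

Let mA a b : measurable (A a b : set (@SphType R n)).
Proof.
rewrite (_ : A a b = S `&` (fun x => (m x)^-1) @^-1` `[a, b[%classic).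
  exact: measurable_sinvm sph_measurable_sphere _ (measurable_itv _).
by apply/seteqP; split=> x /=; rewrite in_itv.
Qed.

Let mW a b : lebesgue_outer.-caratheodory (W a b).
Proof.
pose L := caratheodory_type (lebesgue_outer : {outer_measure set V -> \bar R}).
have mlo : forall U : set V, open U -> measurable (U : set L).
  by move=> U; exact: caratheodory_open.
have mneq : measurable ([set y | y != 0] : set L).
  apply: mlo; rewrite (_ : mkset _ = ~` [set (0 : V)]); last first.
    by apply/seteqP; split=> y /= /eqP.
  by apply: closed_openC; apply: accessible_closed_set1; exact: hausdorff_accessible.
have mf : measurable_fun ([set y | y != 0] : set L) (fun y => enorm y / m y).
  apply: (@within_continuous_measurable _ L V id mlo R
    [set y | y != 0] (fun y => enorm y / m y) mneq).
  apply: continuous_in_subspaceT => x; rewrite inE => x0.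
  have mx0 : m x != 0 by rewrite gt_eqF// mpos.
  exact: (cvgM (@enorm_continuous _ _ x) (cvgV mx0 (@mc x))).
rewrite (_ : W a b = [set y | m y <= 1] `&` ([set y | y != 0] `&`
    (fun y => enorm y / m y) @^-1` `[a, b[%classic)); last first.
  apply/seteqP; split=> x /=; rewrite in_itv/=; first by case.
  by case=> ? [].
apply: (@measurableI _ L); last exact: (mf mneq _ (measurable_itv _)).
rewrite -[X in measurable X]setCK; apply: measurableC; apply: mlo.
apply: closed_openC; rewrite (_ : mkset _ = m @^-1` [set r | r <= 1])//.
by apply: closed_comp; [by move=> x _; exact: mc|exact: closed_le].
Qed.

Let A_normalize a b y : y != 0 ->
  A a b ((enorm y)^-1 *: y) <-> a <= enorm y / m y < b.
Proof.
move=> y0; have e0 : enorm y != 0 by rewrite enorm_eq0.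
rewrite /A /= mZ ?invr_ge0 ?enorm_ge0// invfM invrK.
by split=> [[]//|H]; split => //; exact: sphere_normalize.
Qed.

(** Over [A a b] the body lies between the cones of radius [a] and [b]: this inclusion and the one
    in [W_ge], with the scaling of Lebesgue measure, bound the volume of [W a b]. *)
Let W_le a b : 0 <= a -> a < b ->
  (lebesgue_outer (W a b) <= (b ^+ n)%:E * lebesgue_outer (cone (A a b)))%E.
Proof.
move=> a0 ab; have b0 : 0 < b by exact: le_lt_trans ab.
rewrite -lebesgue_outer_scale//; apply: le_lebesgue_outer => y [my y0 yab].
exists (b^-1 *: y); last by rewrite scalerA divff ?gt_eqF// scale1r.
rewrite coneE /= enormZ gtr0_norm ?invr_gt0//; split.
- by rewrite scaler_eq0 negb_or invr_eq0 gt_eqF.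
- rewrite ler_pdivrMl// mulr1; have /andP[_] := yab.
  rewrite ltr_pdivrMr ?mpos// => /ltW/le_trans; apply.
  by rewrite -[leRHS]mulr1 ler_wpM2l// ltW.
- rewrite invfM invrK scalerA mulrAC divff ?gt_eqF// mul1r.
  exact/A_normalize.
Qed.

Let W_ge a b : 0 < a -> a <= b ->
  ((a ^+ n)%:E * lebesgue_outer (cone (A a b)) <= lebesgue_outer (W a b))%E.
Proof.
move=> a0 ab.
rewrite -lebesgue_outer_scale//; apply: le_lebesgue_outer => _ [z zA <-].
move: zA; rewrite coneE => -[z0 z1 /(A_normalize _ _ z0) zab].
have mz0 : 0 < m z by exact: mpos.
split.
- have /andP[+ _] := zab; rewrite ler_pdivlMr// => az.
  by rewrite mZ ?(ltW a0)//; exact: le_trans az z1.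
- by rewrite scaler_eq0 negb_or z0 gt_eqF.
- by rewrite enormZ mZ ?(ltW a0)// gtr0_norm// -mulf_div divff ?gt_eqF// mul1r.
Qed.

Let W_lty a b : (lebesgue_outer (W a b) < +oo)%E.
Proof.
have [M HM] := gauge_body_bounded.
by apply: (@lebesgue_outer_bounded _ _ n0 _ M) => y [/HM].
Qed.

Let W_fin a b : lebesgue_outer (W a b) \is a fin_num.
Proof. by rewrite ge0_fin_numE ?lebesgue_outer_ge0. Qed.

Let W_between a b : 0 <= a -> a <= b ->
  a ^+ n * fine (sph_measure (A a b)) <= n%:R * fine (lebesgue_outer (W a b)) <=
  b ^+ n * fine (sph_measure (A a b)).
Proof.
move=> a0; rewrite le_eqVlt => /predU1P[<-|ab].
  have -> : A a a = set0.
    by apply/seteqP; split => x // -[_ /andP[/le_lt_trans H /H]]; rewrite ltxx.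
  have -> : W a a = set0.
    by apply/seteqP; split => x // -[_ _ /andP[/le_lt_trans H /H]]; rewrite ltxx.
  by rewrite measure0 lebesgue_outer0 /= !mulr0 lexx.
rewrite fine_sph_measure !(mulrCA _ n%:R); apply/andP; split; apply: ler_wpM2l => //.
  (* Scaling needs a positive factor; at [a = 0] the lower bound is 0 because [n] is positive. *)
  move: a0; rewrite le_eqVlt => /predU1P[<-|a0].
    by rewrite expr0n gtn_eqF// mul0r fine_ge0// lebesgue_outer_ge0.
  rewrite -lee_fin EFinM !fineK ?lebesgue_outer_cone_fin//.
  exact: W_ge (ltW ab).
rewrite -lee_fin EFinM !fineK ?lebesgue_outer_cone_fin//; exact: W_le.
Qed.

Let split_itv (r x y z : R) : x <= y -> y <= z ->
  (x <= r < z) = (x <= r < y) || (y <= r < z).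
Proof.
move=> xy yz; case: (ltP r y) => [ry|yr]; rewrite ?andbT ?andbF ?orbF/=.
  by rewrite (lt_le_trans ry yz) andbT.
by rewrite (le_trans xy yr).
Qed.

Lemma volume_polar :
  volume [set x | m x <= 1] = n%:R^-1 * Rintegral sph_measure S (fun x => (m x)^-1 ^+ n).
Proof.
have [c [C [c0 cC cm]]] := gauge_bounds.
(* The radial function is at most [c^-1]; adding 1 fits it into a half-open interval. *)
pose b := c^-1 + 1.
have b0 : 0 <= b by rewrite addr_ge0// invr_ge0 ltW.
have Sb x : sphere x -> 0 <= (m x)^-1 < b.
  move=> Sx; have /andP[cx _] := cm _ Sx.
  rewrite invr_ge0 (ltW (mpos (sphere_neq0 Sx)))/=.
  rewrite (@le_lt_trans _ _ c^-1)// ?ltrDl//.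
  by rewrite lef_pV2// posrE mpos ?sphere_neq0.
have SA : S = A 0 b by apply/seteqP; split=> x; [move=> Sx; split=> //; exact: Sb|case].
have KW : [set x | m x <= 1] = W 0 b `|` [set 0].
  apply/seteqP; split=> x /=.
    move=> mx; have [->|x0] := eqVneq x 0; first by right.
    left; split => //; apply/A_normalize => //; rewrite -SA.
    exact: sphere_normalize.
  case=> [[]//|->]; by rewrite -(scale0r (0 : V)) mZ// mul0r.
have ZE : lebesgue_outer [set (0 : V)] = 0%E.
  apply/eqP; rewrite eq_le lebesgue_outer_ge0 andbT.
  apply: (@le_trans _ _ (lebesgue_outer (cbox 0 (0 : V)))).
    by apply: le_lebesgue_outer => _ -> i; rewrite mxE lexx.
  rewrite (le_trans (lebesgue_outer_cbox n0 _ _))// lee_fin /bvol.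
  by rewrite (bigD1 (Ordinal n0))//= mxE subrr maxxx mul0r.
have -> : volume [set x | m x <= 1] = fine (lebesgue_outer (W 0 b)).
  rewrite /volume KW; congr fine; apply/eqP; rewrite eq_le; apply/andP; split.
    rewrite (le_trans (@outer_measureU2 _ _
      (lebesgue_outer : {outer_measure set V -> \bar R}) _ _))//=.
    by rewrite ZE adde0.
  by apply: le_lebesgue_outer => x; left.
have [D D0 lipD] := @exprn_lipschitz R n b b0.
have Sfin x y : (sph_measure (A x y : set (@SphType R n)) < +oo)%E by exact: sph_measure_lty.
have Adisj x y z : [disjoint A x y & A y z].
  apply/eqP; apply/seteqP; split=> t // -[[_ /andP[_ t1]] [_ /andP[t2 _]]].
  by have := le_lt_trans t2 t1; rewrite ltxx.
have AU x y z : x <= y -> y <= z -> A x z = A x y `|` A y z.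
  move=> xy yz; apply/seteqP; split=> t; rewrite /A/=.
    by rewrite (split_itv _ xy yz) => -[St /orP[?|?]]; [left|right].
  by rewrite (split_itv _ xy yz) => -[[St ->]|[St ->]]; rewrite ?orbT.
have WU x y z : x <= y -> y <= z -> W x z = W x y `|` W y z.
  move=> xy yz; apply/seteqP; split=> t; rewrite /W/=.
    by rewrite (split_itv _ xy yz) => -[? ? /orP[?|?]]; [left|right].
  by rewrite (split_itv _ xy yz) => -[[? ? ->]|[? ? ->]]; rewrite ?orbT.
pose F (x : @SphType R n) := (m x)^-1 ^+ n.
have mF x y : measurable_fun (A x y : set (@SphType R n)) F.
  apply: (@measurable_funS _ _ _ _ S) => //; first exact: sph_measurable_sphere.
    by move=> ? [].
  exact: measurable_funX.
have iF x y : sph_measure.-integrable (A x y) (EFin \o F).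
  apply: (@bounded_integrable _ _ _ _ _ _ (b ^+ n)) => //.
  move=> z [/Sb /andP[z0 zb] _]; rewrite ger0_norm ?exprn_ge0//.
  by rewrite lerXn2r ?nnegrE// ltW.
apply: (mulfI (_ : n%:R != 0 :> R)); first by rewrite pnatr_eq0 -lt0n.
rewrite mulrA divff ?mul1r ?pnatr_eq0 -?lt0n//.
apply/eqP; rewrite -subr_eq0 SA; apply/eqP.
(* Both $n\lambda(W)$ and the integral lie between $x^n\sigma(A)$ and $y^n\sigma(A)$, and
   $y^n-x^n\le D(y-x)$ on $[0,b]$; hence the comparison function $D\,\sigma(A)$. *)
apply: (@additive_interval_eq0 _
  (fun x y => n%:R * fine (lebesgue_outer (W x y)) - Rintegral sph_measure (A x y) F)
  (fun x y => D * fine (sph_measure (A x y : set (@SphType R n)))) 0 b) => //.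
- move=> x y z x0 xy yz zb; rewrite (AU x y z)// Rintegral_setU//; last first.
    by rewrite -AU.
  rewrite (WU x y z)//.
  rewrite (@fine_measureU _ _ _ (lebesgue_outer : {outer_measure set V -> \bar R}))//=.
  + by rewrite opprD mulrDr addrACA.
  + exact: mW.
  + exact: mW.
  + apply/eqP; apply/seteqP; split=> t // -[[_ _ /andP[_ t1]] [_ _ /andP[t2 _]]].
    by have := le_lt_trans t2 t1; rewrite ltxx.
- move=> x y z x0 xy yz zb; rewrite (AU x y z)// fine_measureU//.
  by rewrite mulrDr.
- move=> x y x0 xy yb.
  have /andP[W1 W2] := W_between x0 xy.
  have Fb z : A x y z -> x ^+ n <= F z <= y ^+ n.
    move=> [Sz /andP[xz zy]]; have /andP[z0 _] := Sb _ Sz.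
    by rewrite !lerXn2r ?nnegrE ?(le_trans x0)// ltW.
  have /andP[] := Rintegral_between (mA x y) (Sfin x y) (iF x y) Fb.
  set s := fine _ in W1 W2 * => I1 I2.
  have s0 : 0 <= s by rewrite fine_ge0// measure_ge0.
  have := ler_wpM2r s0 (lipD x y x0 xy yb) => H.
  rewrite (_ : (y - x) * _ = D * (y - x) * s); last by ring.
  rewrite mulrBl in H; rewrite ler_norml; apply/andP; split; lra.
Qed.

End Polar.
End SphericalMeasure.

(** * The gauge of a Wulff shape *)

Lemma within_continuous_cvg (X Y : topologicalType) (A : set X) (f : X -> Y)
    (x : X) (T : Type) (F : set_system T) {FF : Filter F} (v : T -> X) :
  {within A, continuous f} -> A x -> v @ F --> x -> (\forall t \near F, A (v t)) ->
  f (v t) @[t --> F] --> f x.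
Proof.
move=> /subspace_continuousP cf Ax vx Av; apply: (cvg_comp _ _ _ (cf x Ax)).
move=> U /= /vx FU; near=> t; have : A (v t) by near: t.
near: t; exact: FU.
Unshelve. all: by end_near. Qed.

Section Wulff.
Context {R : realType} {n : nat}.
Hypothesis n0 : (0 < n)%N.
Local Notation V := 'rV[R]_n.
Variable Om : set V.
Hypotheses (Om_sph : Om `<=` sphere) (Om_closed : closed Om).
Hypothesis Om_nhemi : ~ in_closed_hemisphere Om.

Lemma Om_compact : compact Om.
Proof. by apply: (bounded_compact (M := 1) Om_closed) => x /Om_sph/normr_sphere. Qed.

Lemma sphere_nonempty : exists v : V, sphere v.
Proof.
pose v : V := const_mx 1; have v0 : v != 0.
  apply/eqP => /rowP/(_ (Ordinal n0)); rewrite !mxE => /eqP; exact/negP/oner_neq0.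
by exists ((enorm v)^-1 *: v); exact: sphere_normalize.
Qed.

(** Otherwise [Om] would lie in the closed hemisphere centred at the direction opposite to [x]. This
    makes the gauge positive and the Wulff shape bounded. *)
Lemma Om_dotp_gt0 x : x != 0 -> exists2 u, Om u & 0 < dotp x u.
Proof.
move=> x0; apply: contrapT => H; apply: Om_nhemi.
exists (- ((enorm x)^-1 *: x)); split.
  have := sphere_normalize x0; rewrite /sphere/= => e1.
  by rewrite -scaleN1r enormZ e1 mulr1 normrN1.
move=> u Omu; split; first exact: Om_sph.
rewrite dotpNr dotpZr oppr_ge0 mulr_ge0_le0 ?invr_ge0 ?enorm_ge0//.
by rewrite leNgt; apply/negP; rewrite dotpC => xu; apply: H; exists u.
Qed.

Lemma Om_nonempty : Om !=set0.
Proof.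
have [v /sphere_neq0 v0] := sphere_nonempty.
by have [u Omu _] := Om_dotp_gt0 v0; exists u.
Qed.

Definition wulff_points (f : V -> R) : set V := [set (f u)^-1 *: u | u in Om].

Definition wulff_gauge (f : V -> R) : V -> R := supp_fun (wulff_points f).

Section OneFunction.
Variable f : V -> R.
Hypotheses (f_cont : {within Om, continuous f}) (f_pos : forall u, Om u -> 0 < f u).
Local Notation m := (wulff_gauge f).
Local Notation K := (wulff Om f).

Lemma wulff_points_compact : compact (wulff_points f).
Proof.
apply: continuous_compact Om_compact; apply/subspace_continuousP => u Omu.
apply: cvgZ; last by apply: cvg_within.
apply: cvgV; first by rewrite gt_eqF// f_pos.
by move/subspace_continuousP : f_cont; apply.
Qed.

Lemma wulff_points_nonempty : wulff_points f !=set0.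
Proof. by have [u Omu] := Om_nonempty; exists ((f u)^-1 *: u), u. Qed.

Let cP := wulff_points_compact.
Let P0 := wulff_points_nonempty.

Lemma wulff_gauge_ge x u : Om u -> dotp x u / f u <= m x.
Proof.
move=> Omu; rewrite mulrC -dotpZr; apply: supp_fun_ge => //.
by exists u.
Qed.

Lemma wulff_gauge_attained x : exists2 u, Om u & m x = dotp x u / f u.
Proof.
have [_ [u Omu <-] [xu _]] := supp_fun_attained cP P0 x.
by exists u; rewrite // /wulff_gauge -xu dotpZr mulrC.
Qed.

Lemma wulff_gauge_continuous : continuous m.
Proof. exact: supp_fun_continuous. Qed.

Lemma wulff_gaugeZ t x : 0 <= t -> m (t *: x) = t * m x.
Proof. exact: supp_funZ. Qed.

Lemma wulff_gauge_gt0 x : x != 0 -> 0 < m x.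
Proof.
move=> /Om_dotp_gt0[u Omu xu]; apply: lt_le_trans (wulff_gauge_ge x Omu).
by rewrite divr_gt0// f_pos.
Qed.

Lemma wulffE : K = [set x | m x <= 1].
Proof.
apply/seteqP; split=> x /=.
  move=> Kx; have [u Omu ->] := wulff_gauge_attained x.
  by rewrite ler_pdivrMr ?f_pos// mul1r; exact: Kx.
move=> mx u Omu; have := le_trans (wulff_gauge_ge x Omu) mx.
by rewrite ler_pdivrMr ?f_pos// mul1r.
Qed.

Lemma wulff_compact : compact K.
Proof.
have [M KM] := gauge_body_bounded wulff_gauge_continuous wulff_gaugeZ wulff_gauge_gt0.
apply: (@bounded_compact _ _ _ M); last by move=> x; rewrite wulffE; exact: KM.
rewrite wulffE (_ : mkset _ = m @^-1` [set r | r <= 1])//.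
by apply: closed_comp; [move=> x _; exact: wulff_gauge_continuous|exact: closed_le].
Qed.

Lemma wulff0 : K 0.
Proof. by move=> u Omu; rewrite dot0p ltW// f_pos. Qed.

Let K0 : K !=set0. Proof. by exists 0; exact: wulff0. Qed.
Let cK := wulff_compact.

Lemma wulff_ball : exists2 r, 0 < r & forall x, enorm x <= r -> K x.
Proof.
have [c [C [c0 cC cm]]] :=
  gauge_bounds wulff_gauge_continuous wulff_gauge_gt0.
have C0 : 0 < C by exact: lt_le_trans cC.
exists C^-1 => [|x]; first by rewrite invr_gt0.
rewrite wulffE /=; have [->|x0] := eqVneq x 0.
  by rewrite -(scale0r (0 : V)) wulff_gaugeZ// mul0r.
move=> xC; rewrite (gauge_enorm wulff_gaugeZ).
have /andP[_ mC] := cm _ (sphere_normalize x0).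
rewrite -[leRHS](mulVf (lt0r_neq0 C0)); apply: ler_pM => //.
  exact: enorm_ge0.
by rewrite ltW// wulff_gauge_gt0//; apply/sphere_neq0/sphere_normalize.
Qed.

Lemma supp_wulff_gt0 u : sphere u -> 0 < supp_fun K u.
Proof.
move=> Su; have [r r0 rK] := wulff_ball.
apply: lt_le_trans (supp_fun_ge cK K0 u (rK (r *: u) _)); last first.
  by rewrite enormZ Su mulr1 gtr0_norm.
by rewrite dotpZr dotp_sphere// mulr1.
Qed.

Lemma radial_wulff xi : sphere xi -> radial_fun K xi = (m xi)^-1.
Proof.
move=> Sxi; have m0 := wulff_gauge_gt0 (sphere_neq0 Sxi).
rewrite /radial_fun (_ : mkset _ = `[0, (m xi)^-1]%classic).
  by rewrite sup_itvcc// invr_ge0 ltW.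
rewrite wulffE; apply/seteqP; split=> t /=; rewrite in_itv/=.
  by move=> [t0]; rewrite wulff_gaugeZ// t0 -ler_pdivlMr// div1r.
by move=> /andP[t0 tm]; split=> //; rewrite wulff_gaugeZ// -ler_pdivlMr// div1r.
Qed.

(** On [Om] one always has $h_K\le f$, and the boundary point [(m xi)^-1 *: xi] attains the
    constraint at [u]. Thus the density, written with $h_K$, can be expressed through [f]. *)
Lemma maximizer_supp_wulff xi u : sphere xi -> Om u -> m xi = dotp xi u / f u ->
  supp_fun K u = f u.
Proof.
move=> Sxi Omu mu; have m0 := wulff_gauge_gt0 (sphere_neq0 Sxi).
have f0 := f_pos Omu.
apply/eqP; rewrite eq_le; apply/andP; split.
  by apply: supp_fun_le => // x Kx; rewrite dotpC; exact: Kx.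
have Kp : K ((m xi)^-1 *: xi).
  by rewrite wulffE /= wulff_gaugeZ ?invr_ge0 ?(ltW m0)// mulVf// gt_eqF.
apply: le_trans (supp_fun_ge cK K0 u Kp).
by rewrite dotpZr ler_pdivlMl// -ler_pdivlMr// dotpC -mu.
Qed.

Lemma maximizer_rgauss xi u : sphere xi -> Om u -> m xi = dotp xi u / f u ->
  rgauss K xi u.
Proof.
move=> Sxi Omu mu; split; first exact: Om_sph.
rewrite radial_wulff// (maximizer_supp_wulff Sxi Omu mu) dotpZl.
have m0 := wulff_gauge_gt0 (sphere_neq0 Sxi).
have f0 := f_pos Omu.
by apply: (mulfI (lt0r_neq0 m0)); rewrite mulrA divff ?gt_eqF// mul1r mu divfK// gt_eqF.
Qed.

(** The polar body of [K]. It replaces [wulff_points] here because normals at a corner of [K] need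
    not lie in [Om], while singular directions are defined by all normals. *)
Let Q : set V := [set y | forall x, K x -> dotp x y <= 1].

Let cQ : compact Q.
Proof.
have [r r0 rK] := wulff_ball.
apply: (@bounded_compact _ _ _ r^-1) => [|y Qy].
  rewrite (_ : Q = \bigcap_(x in K) dotp x @^-1` [set s | s <= 1])//.
  apply: closed_bigI => x _; apply: closed_comp; last exact: closed_le.
  by move=> y _; exact: dotp_continuousr.
apply: (le_trans (normr_le_enorm y)).
have [->|y0] := eqVneq y 0; first by rewrite enorm0 invr_ge0 ltW.
have Sy := sphere_normalize y0.
have Ky : K (r *: ((enorm y)^-1 *: y)).
  by apply: rK; rewrite enormZ Sy mulr1 gtr0_norm.
have yy : dotp y y = enorm y * enorm y by rewrite -expr2 sqr_sqrtr// dotpp_ge0.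
have := Qy _ Ky; rewrite !dotpZl yy mulKf ?enorm_eq0//.
by rewrite -ler_pdivlMl// mulr1.
Qed.

Let Q0 : Q !=set0.
Proof. by exists 0 => x _; rewrite dotpC dot0p. Qed.

Definition wulff_singular : set V :=
  [set xi | sphere xi /\ exists u v, [/\ rgauss K xi u, rgauss K xi v & u <> v]].

(* A normal u at the boundary point in direction xi, rescaled to u / h_K(u),
   maximizes the linear form xi over the polar body Q of K. *)
Let rgauss_polar xi u : sphere xi -> rgauss K xi u ->
  Q ((supp_fun K u)^-1 *: u) /\ dotp xi ((supp_fun K u)^-1 *: u) = supp_fun Q xi.
Proof.
move=> Sxi [Su]; rewrite radial_wulff// dotpZl => xu.
have h0 := supp_wulff_gt0 Su.
have m0 := wulff_gauge_gt0 (sphere_neq0 Sxi).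
have Qu : Q ((supp_fun K u)^-1 *: u).
  move=> x Kx; rewrite dotpZr mulrC ler_pdivrMr// mul1r dotpC.
  exact: supp_fun_ge.
split => //; have xum : dotp xi ((supp_fun K u)^-1 *: u) = m xi.
  have d0 : dotp xi u != 0.
    by apply/eqP => d0; move: h0; rewrite -xu d0 mulr0 ltxx.
  by rewrite dotpZr -xu invfM invrK -mulrA mulVf// mulr1.
apply/eqP; rewrite eq_le supp_fun_ge// xum/=.
apply: supp_fun_le => // y Qy.
have Kp : K ((m xi)^-1 *: xi).
  by rewrite wulffE /= wulff_gaugeZ ?invr_ge0 ?(ltW m0)// mulVf// gt_eqF.
by have := Qy _ Kp; rewrite dotpZl ler_pdivrMl// mulr1.
Qed.

(** Distinct unit normals rescale to distinct points of [Q], so the cone over the singular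
    directions consists of points with several maximizers over [Q]. *)
Lemma wulff_singular_null :
  sph_measure (wulff_singular : set (@SphType R n)) = 0%E.
Proof.
have -> : sph_measure (wulff_singular : set (@SphType R n)) =
  (n%:R%:E * lebesgue_outer (cone wulff_singular))%E by [].
rewrite (_ : lebesgue_outer _ = 0%E) ?mule0//.
apply/eqP; rewrite eq_le lebesgue_outer_ge0 andbT -(nonuniq_null n0 cQ Q0 1).
apply: le_lebesgue_outer => y yN; split; last first.
  exact: le_trans (normr_le_enorm y) (cone_enorm yN).
move: yN => [t [xi [/andP[t0 _] [Sxi [u [v [xu xv uv]]]] _ ->]]].
have [Qu xiu] := rgauss_polar Sxi xu; have [Qv xiv] := rgauss_polar Sxi xv.
exists ((supp_fun K u)^-1 *: u), ((supp_fun K v)^-1 *: v).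
split => //; try by rewrite supp_funZ ?ltW// dotpZl ?xiu ?xiv.
have [[Su _] [Sv _]] := (xu, xv).
by move/sphereZ_inj => H; apply: uv; apply: H => //; rewrite invr_gt0 supp_wulff_gt0.
Qed.

Definition wulff_regular : set V := sphere `\` wulff_singular.

(** The gauge is attained at some [u] in [Om], which is then a normal; as there is only one normal,
    it is [alphaK], which therefore lies in [Om]. *)
Lemma wulff_regularP xi : wulff_regular xi ->
  [/\ Om (alphaK K xi), rgauss K xi = [set alphaK K xi],
      m xi = dotp xi (alphaK K xi) / f (alphaK K xi),
      supp_fun K (alphaK K xi) = f (alphaK K xi) &
      forall u, Om u -> m xi = dotp xi u / f u -> u = alphaK K xi].
Proof.
move=> [Sxi Nxi].
have uniq u v : rgauss K xi u -> rgauss K xi v -> u = v.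
  by move=> xu xv; apply: contrapT => uv; apply: Nxi; split => //; exists u, v.
have [u Omu mu] := wulff_gauge_attained xi.
have xu := maximizer_rgauss Sxi Omu mu.
have ga : rgauss K xi (alphaK K xi) by exact: (xgetI _ xu).
have -> : alphaK K xi = u by exact: uniq.
split => //.
- by apply/seteqP; split=> [v xv|_ -> //]; exact: uniq.
- exact: maximizer_supp_wulff mu.
- by move=> v Omv mv; apply: uniq => //; exact: maximizer_rgauss mv.
Qed.

(** By compactness the ratio has a maximum over [Om] outside [U], smaller than [m xi] by uniqueness.
    Near-maximizers are thereby forced close to [alphaK]. *)
Lemma wulff_regular_gap xi (U : set V) : wulff_regular xi -> open U ->
  U (alphaK K xi) -> exists2 del, 0 < del &
  forall u, Om u -> ~ U u -> dotp xi u / f u <= m xi - del.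
Proof.
move=> Rxi oU Ua; have [Oma _ ma _ uniq] := wulff_regularP Rxi.
have [OU|/set0P OU] := eqVneq (Om `&` ~` U) set0.
  exists 1 => // u Omu Uu; exfalso.
  by have : (Om `&` ~` U) u by []; rewrite OU.
have cOU : compact (Om `&` ~` U).
  by apply: compact_closedI Om_compact _; exact: open_closedC.
have cphi : {within Om `&` ~` U, continuous (fun u => dotp xi u / f u)}.
  apply: (continuous_subspaceW (_ : _ `<=` Om)); first by move=> ? [].
  apply/subspace_continuousP => u Omu.
  apply: cvgM; first by apply: cvg_within_filter; exact: dotp_continuousr.
  apply: cvgV; first by rewrite gt_eqF// f_pos.
  by move/subspace_continuousP : f_cont; apply.
have [v] := EVT_max_rV OU cOU cphi.
rewrite inE => -[Omv Uv] vmax.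
exists (m xi - dotp xi v / f v).
  rewrite subr_gt0 lt_neqAle wulff_gauge_ge// andbT.
  by apply/eqP => /esym /uniq - /(_ Omv) va; apply: Uv; rewrite va.
by move=> u Omu Uu; rewrite subKr; apply: vmax; rewrite inE.
Qed.

(** The normal at [eta] nearly maximizes the ratio at [xi]: replacing [eta] by [xi] costs at most
    $nB|\xi-\eta|$ in the ratio and $C|\xi-\eta|$ in the gauge, together less than the gap. *)
Lemma alphaK_continuous : {within wulff_regular, continuous (alphaK K)}.
Proof.
apply/subspace_continuousP => xi Rxi U; rewrite nbhsE => -[W [oW Wa] WU].
have [Oma _ ma _ uniq] := wulff_regularP Rxi.
have [del del0 gap] := wulff_regular_gap Rxi oW Wa.
have [B B0 PB] := compact_normr_bound cP.
have [C C0 lipC] := supp_fun_lipschitz cP P0.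
pose e := del / (n%:R * B + C + 1).
have nB : 0 <= n%:R * B by rewrite mulr_ge0// ltW.
have D0 : 0 < n%:R * B + C + 1 by lra.
rewrite /within /=; apply/nbhs_ballP; exists e; first by rewrite /= divr_gt0.
move=> eta; rewrite -ball_normE /= => xe Reta; apply: WU.
have [Omb _ mb _ _] := wulff_regularP Reta.
apply: contrapT => Wb; have := gap _ Omb Wb.
set b := alphaK K eta in Omb mb *.
have H1 : dotp eta b / f b <= dotp xi b / f b + n%:R * B * `|xi - eta|.
  have Pb : wulff_points f ((f b)^-1 *: b) by exists b.
  rewrite -lerBlDl mulrC -dotpZr (mulrC (dotp xi b)) -dotpZr -dotpBl.
  apply: (le_trans (ler_norm _)); apply: (le_trans (normr_dotp _ _)).
  by rewrite mulrAC distrC ler_wpM2r// ler_wpM2l// PB.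
have H2 : m xi - m eta <= C * `|xi - eta|.
  exact: le_trans (ler_norm _) (lipC _ _).
have H3 : (n%:R * B + C + 1) * `|xi - eta| < del.
  by move: xe; rewrite /e ltr_pdivlMr// mulrC.
have : 0 <= `|xi - eta| by [].
lra.
Qed.

End OneFunction.
End Wulff.

(** * Perturbation of the gauge *)

Lemma cvg_dnbhs0_lipschitz (R : realType) (h : R -> R) (C : R) :
  (\forall e \near 0^', `|h e| <= C * `|e|) -> h e @[e --> 0^'] --> 0.
Proof.
move=> hC; apply/cvgr0Pnorm_le => eps eps0; near=> e.
have C0 : 0 < `|C| + 1 by rewrite ltr_pwDr.
apply: (@le_trans _ _ ((`|C| + 1) * `|e|)).
  apply: (@le_trans _ _ (C * `|e|)); first by near: e.
  by rewrite ler_wpM2r// (le_trans (ler_norm _))// lerDl.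
rewrite -ler_pdivlMl//; near: e; apply: dnbhs0_le.
by rewrite mulr_gt0// invr_gt0.
Unshelve. all: by end_near. Qed.

(** The derivative $k\,r_0^{k-1}L$ is written with [L / r0], which spares the case [k = 0]; the
    induction is the product rule. *)
Lemma cvg_difference_quotientX (R : realType) (r : R -> R) (r0 L : R) (k : nat) :
  r e @[e --> 0^'] --> r0 -> r0 != 0 ->
  (r e - r0) / e @[e --> 0^'] --> L ->
  (r e ^+ k - r0 ^+ k) / e @[e --> 0^'] --> k%:R * r0 ^+ k * (L / r0).
Proof.
move=> rr0 r00 rL; elim: k => [|k IH].
  under eq_fun do rewrite !expr0 subrr mul0r.
  by rewrite !mul0r; exact: cvg_cst.
rewrite (_ : (fun e => _) = (fun e => r e * ((r e ^+ k - r0 ^+ k) / e) +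
    (r e - r0) / e * r0 ^+ k)); last first.
  by apply/funext => e; rewrite !exprS; ring.
rewrite (_ : _ * _ * _ = r0 * (k%:R * r0 ^+ k * (L / r0)) + L * r0 ^+ k).
  by apply: cvgD; apply: cvgM => //; exact: cvg_cst.
by rewrite exprS -natr1; field.
Qed.

Section Perturbation.
Context {R : realType} {n : nat}.
Hypothesis n0 : (0 < n)%N.
Local Notation V := 'rV[R]_n.
Variable Psi : V -> R -> R.
Hypothesis Psi_der : forall xi t, sphere xi -> 0 < t -> derivable (Psi xi) t 1.
Hypothesis Psi_t_cont : {within dom_St, continuous (fun p : V * R => Psi_t Psi p.1 p.2)}.
Variable s : R.
Hypothesis Psi_t_sign : forall xi t, sphere xi -> 0 < t -> 0 < s * Psi_t Psi xi t.

Variable Om : set V.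
Hypotheses (Om_sph : Om `<=` sphere) (Om_closed : closed Om).
Hypothesis Om_nhemi : ~ in_closed_hemisphere Om.
Variables f g : V -> R.
Hypotheses (f_cont : {within Om, continuous f}) (f_pos : forall xi, Om xi -> 0 < f xi).
Hypothesis g_cont : {within Om, continuous g}.
Variables (fe : R -> V -> R) (d : R).
Hypothesis d0 : 0 < d.
Hypothesis fe_cont : forall e, `|e| < d -> {within Om, continuous (fe e)}.
Hypothesis fe_pos : forall e, `|e| < d -> forall xi, Om xi -> 0 < fe e xi.
Hypothesis feE : forall e, `|e| < d -> forall xi, Om xi ->
  Psi xi (fe e xi) = Psi xi (f xi) + e * g xi.

Let cOm := Om_compact Om_sph Om_closed.
Let Om0 := Om_nonempty n0 Om_sph Om_nhemi.

Lemma Psi_mvt u x y : sphere u -> 0 < x -> x <= y ->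
  exists2 th, x <= th <= y & Psi u y - Psi u x = Psi_t Psi u th * (y - x).
Proof.
move=> Su x0 xy.
have H z : x <= z -> derivable (Psi u) z 1.
  by move=> xz; apply: Psi_der => //; exact: lt_le_trans xz.
have [z||th + E] := @MVT_segment R (Psi u) (Psi_t Psi u) x y xy.
- rewrite in_itv/= => /andP[xz zy]; rewrite /Psi_t derive1E.
  by apply/derivableP/H/ltW.
- apply: derivable_within_continuous => z; rewrite in_itv/= => /andP[xz _].
  exact: H.
by rewrite in_itv/=; exists th.
Qed.

Lemma Psi_increasing u x y : sphere u -> 0 < x -> x <= y ->
  s * Psi u x <= s * Psi u y.
Proof.
move=> Su x0 xy; rewrite -subr_ge0 -mulrBr.
have [th /andP[xth _] ->] := Psi_mvt Su x0 xy.
rewrite mulrA mulr_ge0 ?subr_ge0// ltW// Psi_t_sign//.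
exact: lt_le_trans xth.
Qed.

Lemma positive_bounds : exists a b, [/\ 0 < a, a <= b & forall u, Om u -> a <= f u <= b].
Proof.
have [x xO xmin] := EVT_min_rV Om0 cOm f_cont.
have [y yO ymax] := EVT_max_rV Om0 cOm f_cont.
exists (f x), (f y); split; last by move=> z zS; rewrite xmin ?ymax ?inE.
  by apply: f_pos; move: xO; rewrite inE.
exact: xmin.
Qed.

Lemma Psi_t_lower_bound a b : 0 < a -> a <= b ->
  exists2 c, 0 < c & forall u t, Om u -> a <= t <= b -> c <= s * Psi_t Psi u t.
Proof.
move=> a0 ab.
pose B : set (V * R) := Om `*` `[a, b]%classic.
have cB : compact B by apply: compact_setX => //; exact: segment_compact.
have BD : B `<=` dom_St.
  move=> [u t] [/= Omu]; rewrite in_itv/= => /andP[t0 _]; split => /=.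
    exact: Om_sph.
  exact: lt_le_trans t0.
have B0 : B !=set0.
  by have [u Omu] := Om0; exists (u, a); split => //=; rewrite in_itv/= lexx.
have cP : {within B, continuous (fun p : V * R => s * Psi_t Psi p.1 p.2)}.
  apply/subspace_continuousP => p Bp; apply: cvgM; first exact: cvg_cst.
  by move/(continuous_subspaceW BD)/subspace_continuousP : Psi_t_cont; apply.
have [[u t]] := compact_EVT_min B0 cB cP.
rewrite inE => /BD[/= Su t0] utmin.
exists (s * Psi_t Psi u t); first exact: Psi_t_sign.
by move=> v r Omv rab; apply: (utmin (v, r)); rewrite inE; split.
Qed.

(** Let $a\le f\le b$ on [Om] and $s\Psi_t\ge c>0$ on $[a/2,b+a/2]$. A deviation of [fe e] from [f]
    by $a/2$ or more would, by monotonicity and the mean value theorem, change $s\Psi$ by at least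
    $ca/2$, more than $|e||sg|$. So [fe e] stays within $a/2$ of [f], and the mean value theorem
    gives the bound linear in $|e|$, uniform in [u]. The [a] of the conclusion is this $a/2$. *)
Lemma perturbation_bounds : exists a c C d1 : R, [/\ 0 < a, 0 < c, 0 <= C, 0 < d1 <= d &
  forall e u, `|e| < d1 -> Om u -> [/\ a <= f u, a <= fe e u,
    c <= s * Psi_t Psi u (f u), `|fe e u - f u| <= C * `|e| &
    exists th, [/\ 0 < th, `|th - f u| <= C * `|e| &
      e * g u = Psi_t Psi u th * (fe e u - f u)]]].
Proof.
have [a [b [a0 ab fab]]] := positive_bounds.
have a20 : 0 < a / 2 by lra.
have [c c0 cP] := @Psi_t_lower_bound (a / 2) (b + a / 2) a20 (ltac:(lra)).
have [|x xO xmax] := @EVT_max_rV _ _ (fun u => `|g u|) Om Om0 cOm.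
  apply/subspace_continuousP => u Omu; apply: cvg_norm.
  by move/subspace_continuousP : g_cont; apply.
pose G := `|s| * `|g x|.
have Gu u : Om u -> `|s * g u| <= G.
  by move=> Omu; rewrite normrM ler_wpM2l// xmax ?inE.
have G0 : 0 <= G by rewrite mulr_ge0.
(* Ensures $|e|G<ca/2$; the 1 keeps the denominator positive when [g] vanishes on [Om]. *)
pose d1 := Num.min d (c * (a / 2) / (G + 1)).
have d10 : 0 < d1 by rewrite lt_min d0/= divr_gt0 ?mulr_gt0// ltr_pwDr.
exists (a / 2), c, (G / c), d1; split => //; first by rewrite divr_ge0// ltW.
  by rewrite d10 ge_min lexx.
move=> e u; rewrite lt_min => /andP[ed]; rewrite ltr_pdivlMr; last by rewrite ltr_pwDr.
move=> eG Omu; have Su := Om_sph Omu.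
have /andP[fa fb] := fab u Omu.
have fe0 := fe_pos ed Omu.
have E := feE ed Omu.
have esg : `|s * (Psi u (fe e u) - Psi u (f u))| < c * (a / 2).
  rewrite E addrC addKr mulrCA normrM.
  apply: le_lt_trans eG; apply: (@le_trans _ _ (`|e| * G)).
    by rewrite ler_wpM2l// Gu.
  by rewrite ler_wpM2l// lerDl.
have near : `|fe e u - f u| < a / 2.
  rewrite ltr_norml; apply/andP; split.
    rewrite ltNge; apply/negP => H.
    have H1 : fe e u <= f u - a / 2 by lra.
    have H2 := Psi_increasing Su fe0 H1.
    have [||th /andP[t1 t2] T] := @Psi_mvt u (f u - a / 2) (f u) Su; [lra|lra|].
    have H3 := cP u th Omu (ltac:(lra)).
    move: esg; rewrite ltr_norml => /andP[H4 _].
    have H5 := ler_wpM2r (ltW a20) H3.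
    have := congr1 ( *%R s) T; rewrite subKr mulrBr mulrA => H6.
    lra.
  rewrite ltNge; apply/negP => H.
  have H1 : f u + a / 2 <= fe e u by lra.
  have H2 := Psi_increasing Su (ltac:(lra) : 0 < f u + a / 2) H1.
  have [||th /andP[t1 t2] T] := @Psi_mvt u (f u) (f u + a / 2) Su; [lra|lra|].
  have H3 := cP u th Omu (ltac:(lra)).
  move: esg; rewrite ltr_norml => /andP[_ H4].
  have H5 := ler_wpM2r (ltW a20) H3.
  have := congr1 ( *%R s) T; rewrite (addrC (f u)) addrK mulrBr mulrA (addrC _ (f u)) => H6.
  lra.
have [th [th1 th2 th3]] : exists th, [/\ a / 2 <= th <= b + a / 2,
    `|th - f u| <= `|fe e u - f u| &
    Psi u (fe e u) - Psi u (f u) = Psi_t Psi u th * (fe e u - f u)].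
  move: near; rewrite ltr_norml => /andP[near1 near2].
  have [ff|ff] := leP (f u) (fe e u).
    have [|th /andP[t1 t2] T] := Psi_mvt Su _ ff; first exact: f_pos.
    exists th; split => //; first by apply/andP; split; lra.
    by rewrite !ger0_norm ?subr_ge0// lerD2r.
  have [th /andP[t1 t2] T] := Psi_mvt Su fe0 (ltW ff).
  exists th; split => //; first by apply/andP; split; lra.
    by rewrite !ler0_norm ?subr_le0// ?lerN2 ?lerD2r// ltW.
  by rewrite -opprB T -mulrN opprB.
have Cle : `|fe e u - f u| <= G / c * `|e|.
  rewrite mulrAC ler_pdivlMr//.
  apply: (@le_trans _ _ (`|s * (Psi u (fe e u) - Psi u (f u))|)).
    rewrite th3 mulrA normrM mulrC ler_wpM2r//.
    by rewrite (le_trans (cP u th Omu th1))// ler_norm.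
  by rewrite E addrC addKr mulrCA normrM mulrC ler_wpM2r// Gu.
split => //.
- lra.
- move: near; rewrite ltr_norml => /andP[near1 near2]; lra.
- by apply: cP => //; apply/andP; split; lra.
- exists th; split; [lra|exact: le_trans th2 Cle|].
  by rewrite -th3 E addrC addKr.
Qed.

Local Notation K := (wulff Om f).
Local Notation m := (wulff_gauge Om f).
Local Notation me e := (wulff_gauge Om (fe e)).

(** The gauges are maxima over [Om] of ratios that are uniformly close, so testing each with the
    maximizer of the other shows that they are as close. *)
Lemma gauge_perturbation_lipschitz : exists C d1 : R, [/\ 0 <= C, 0 < d1 <= d,
  forall e xi u, `|e| < d1 -> sphere xi -> Om u ->
    `|dotp xi u / fe e u - dotp xi u / f u| <= C * `|e| &
  forall e xi, `|e| < d1 -> sphere xi -> `|me e xi - m xi| <= C * `|e|].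
Proof.
have [a [c [C [d1 [a0 c0 C0 /andP[d10 d1d] H]]]]] := perturbation_bounds.
(* $|1/f_e-1/f|\le C|e|/a^2$, and [n] bounds the scalar product of unit vectors through
   [normr_dotp]. *)
pose D := n%:R * C / (a * a).
have D0 : 0 <= D by rewrite divr_ge0 ?mulr_ge0// ltW.
have quot e xi u : `|e| < d1 -> sphere xi -> Om u ->
    `|dotp xi u / fe e u - dotp xi u / f u| <= D * `|e|.
  move=> ed Sxi Omu; have [fa fea _ fC _] := H e u ed Omu.
  have fu0 : 0 < f u by exact: lt_le_trans fa.
  have feu0 : 0 < fe e u by exact: lt_le_trans fea.
  rewrite (_ : _ - _ = dotp xi u * (- (fe e u - f u)) / (fe e u * f u)); last first.
    by field; rewrite !gt_eqF.
  rewrite normrM normfV (gtr0_norm (mulr_gt0 feu0 fu0)) ler_pdivrMr ?mulr_gt0//.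
  have -> : D * `|e| * (fe e u * f u) =
      n%:R * (C * `|e|) * ((fe e u / a) * (f u / a)).
    by rewrite /D; field; rewrite gt_eqF.
  rewrite normrM normrN -[leLHS]mulr1 ler_pM ?mulr_ge0//.
    rewrite ler_pM// (le_trans (normr_dotp _ _))//.
    rewrite -mulrA ler_piMr// mulr_ile1// normr_sphere//; exact: Om_sph.
  by rewrite -[leLHS]mulr1 ler_pM// ler_pdivlMr// mul1r.
exists D, d1; split => //; first by rewrite d10.
move=> e xi ed Sxi; have ed' := lt_le_trans ed d1d.
have [u Omu mu] := wulff_gauge_attained n0 Om_sph Om_closed Om_nhemi f_cont f_pos xi.
have [v Omv mv] := wulff_gauge_attained n0 Om_sph Om_closed Om_nhemi
  (fe_cont ed') (fe_pos ed') xi.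
have Hu := wulff_gauge_ge n0 Om_sph Om_closed Om_nhemi (fe_cont ed') (fe_pos ed') xi Omu.
have Hv := wulff_gauge_ge n0 Om_sph Om_closed Om_nhemi f_cont f_pos xi Omv.
have := quot e xi u ed Sxi Omu; have := quot e xi v ed Sxi Omv.
rewrite !ler_norml => /andP[? ?] /andP[? ?]; apply/andP; split; lra.
Qed.

Lemma gauge_perturbation_cvg xi : sphere xi -> me e xi @[e --> 0^'] --> m xi.
Proof.
move=> Sxi; have [C [d1 [C0 /andP[d10 _] _ H]]] := gauge_perturbation_lipschitz.
apply/subr_cvg0; apply: (@cvg_dnbhs0_lipschitz _ _ C).
near=> e; apply: H => //; near: e; exact: dnbhs0_lt.
Unshelve. all: by end_near. Qed.

(** The point may move with [e], since the envelope argument uses both the fixed maximizer and the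
    perturbed ones. The mean value theorem writes $(f_e-f)/e$ as $g/\Psi_t$ at an intermediate
    [th e], which tends to [f u]. *)
Lemma perturbation_quotient_cvg xi u (v : R -> V) : Om u ->
  (\forall e \near 0^', Om (v e)) -> v e @[e --> 0^'] --> u ->
  (dotp xi (v e) / fe e (v e) - dotp xi (v e) / f (v e)) / e @[e --> 0^'] -->
    - (dotp xi u * g u / (Psi_t Psi u (f u) * f u ^+ 2)).
Proof.
move=> Omu Omv vu.
have [a [c [C [d1 [a0 c0 C0 /andP[d10 d1d] H]]]]] := perturbation_bounds.
have fv : f (v e) @[e --> 0^'] --> f u.
  exact: (within_continuous_cvg f_cont Omu vu Omv).
have gv : g (v e) @[e --> 0^'] --> g u.
  exact: (within_continuous_cvg g_cont Omu vu Omv).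
have /choice[th thP] : forall e, exists t, `|e| < d1 -> Om (v e) ->
    [/\ 0 < t, `|t - f (v e)| <= C * `|e| &
      e * g (v e) = Psi_t Psi (v e) t * (fe e (v e) - f (v e))].
  move=> e; have [ed|ed] := pselect (`|e| < d1); last by exists 0.
  have [Ov|Ov] := pselect (Om (v e)); last by exists 0.
  by have [_ _ _ _ [th]] := H e (v e) ed Ov; exists th.
have near_f (w : R -> R) : (\forall e \near 0^', `|w e - f (v e)| <= C * `|e|) ->
    w e @[e --> 0^'] --> f u.
  move=> wC; rewrite -[f u]add0r.
  rewrite (_ : (fun e => w e) = (fun e => (w e - f (v e)) + f (v e))); last first.
    by apply/funext => e; rewrite subrK.
  by apply: cvgD; [exact: (@cvg_dnbhs0_lipschitz _ _ C)|exact: fv].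
have ed1 : \forall e \near (0 : R)^', `|e| < d1 by exact: dnbhs0_lt.
have fev : fe e (v e) @[e --> 0^'] --> f u.
  apply: near_f; near=> e.
  have ed : `|e| < d1 by near: e.
  have Ov : Om (v e) by near: e.
  by have [] := H e (v e) ed Ov.
have thv : th e @[e --> 0^'] --> f u.
  apply: near_f; near=> e.
  have ed : `|e| < d1 by near: e.
  have Ov : Om (v e) by near: e.
  by have [] := thP e ed Ov.
have pv : Psi_t Psi (v e) (th e) @[e --> 0^'] --> Psi_t Psi u (f u).
  apply: (@within_continuous_cvg _ _ dom_St (fun p : V * R => Psi_t Psi p.1 p.2)
    (u, f u) _ (0^') _ (fun e => (v e, th e)) Psi_t_cont).
  - by split; [exact: Om_sph|exact: f_pos].
  - exact: (cvg_pair vu thv).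
  - near=> e; have ed : `|e| < d1 by near: e.
    have Ov : Om (v e) by near: e.
    by split => /=; [exact: Om_sph|have [] := thP e ed Ov].
have xiv : dotp xi (v e) @[e --> 0^'] --> dotp xi u.
  by apply: cvg_dotp => //; exact: cvg_cst.
have P0 : Psi_t Psi u (f u) != 0.
  apply/eqP => E; have := Psi_t_sign (Om_sph Omu) (f_pos Omu).
  by rewrite E mulr0 ltxx.
have f0 : f u != 0 by rewrite gt_eqF// f_pos.
rewrite (_ : - _ = dotp xi u * - (g u / Psi_t Psi u (f u) / (f u * f u))); last first.
  by field; rewrite P0 f0.
apply: (@cvg_trans _ ((fun e => dotp xi (v e) *
    - (g (v e) / Psi_t Psi (v e) (th e) / (f (v e) * fe e (v e)))) @ 0^')); last first.
  have ff0 : f u * f u != 0 by rewrite mulf_neq0.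
  exact: (cvgM xiv (cvgN (cvgM (cvgM gv (cvgV P0 pv)) (cvgV ff0 (cvgM fv fev))))).
apply: near_eq_cvg; near=> e.
have ed : `|e| < d1 by near: e.
have Ov : Om (v e) by near: e.
have e0 : e != 0 by near: e; exact: nbhs_dnbhs_neq.
have [t0 _ E] := thP e ed Ov; have [fa fea _ _ _] := H e (v e) ed Ov.
have Pt0 : Psi_t Psi (v e) (th e) != 0.
  apply/eqP => E0; have := Psi_t_sign (Om_sph Ov) t0.
  by rewrite E0 mulr0 ltxx.
have fv0 : f (v e) != 0 by rewrite gt_eqF// (lt_le_trans a0).
have fev0 : fe e (v e) != 0 by rewrite gt_eqF// (lt_le_trans a0).
have -> : g (v e) = Psi_t Psi (v e) (th e) * (fe e (v e) - f (v e)) / e.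
  by rewrite -E mulrAC divff ?mul1r.
by field; rewrite e0 fv0 fev0 Pt0.
Unshelve. all: by end_near. Qed.

(* Danskin's envelope argument: the quotient lies between those of two families
   of near-maximizers, both converging to the unique maximizer. *)
Lemma gauge_perturbation_derivative xi : wulff_regular Om f xi ->
  (me e xi - m xi) / e @[e --> 0^'] -->
    - (m xi * g (alphaK K xi) /
       (Psi_t Psi (alphaK K xi) (f (alphaK K xi)) * f (alphaK K xi))).
Proof.
move=> Rxi; have Sxi : sphere xi by case: Rxi.
have [Omu _ mu _ _] := wulff_regularP n0 Om_sph Om_closed Om_nhemi f_cont f_pos Rxi.
have gap := wulff_regular_gap n0 Om_sph Om_closed Om_nhemi f_cont f_pos Rxi.
set u := alphaK K xi in Omu mu gap *.
have [C [d1 [C0 /andP[d10 d1d] qC mC]]] := gauge_perturbation_lipschitz.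
have /choice[v vP] : forall e, exists v, `|e| < d1 ->
    Om v /\ me e xi = dotp xi v / fe e v.
  move=> e; have [ed|ed] := pselect (`|e| < d1); last by exists 0.
  have ed' := lt_le_trans ed d1d.
  have [w Omw mw] := wulff_gauge_attained n0 Om_sph Om_closed Om_nhemi
    (fe_cont ed') (fe_pos ed') xi.
  by exists w.
have ed1 : \forall e \near (0 : R)^', `|e| < d1 by exact: dnbhs0_lt.
have Omv : \forall e \near 0^', Om (v e).
  by near=> e; have [] := vP e => //; near: e.
have vu : v e @[e --> 0^'] --> u.
  move=> U; rewrite nbhsE => -[W [oW Wu] WU].
  have [del del0 Hdel] := gap W oW Wu.
  (* One [C] pays for the change of the ratio at [v e], the other for the change of the gauge; the
     sum stays below the gap [del]. *)
  have ed2 : \forall e \near (0 : R)^', `|e| < del / (C + C + 1).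
    by apply: dnbhs0_lt; rewrite divr_gt0// ltr_pwDr// addr_ge0.
  rewrite /nbhs /=; near=> e; apply: WU; apply: contrapT => Wv.
  have ed : `|e| < d1 by near: e.
  have [Ov mv] := vP e ed.
  have H1 := Hdel _ Ov Wv.
  have := qC e xi (v e) ed Sxi Ov; have := mC e xi ed Sxi.
  rewrite !ler_norml => /andP[H2 _] /andP[_ H3].
  have : `|e| < del / (C + C + 1) by near: e.
  rewrite ltr_pdivlMr ?ltr_pwDr ?addr_ge0// => H4.
  have e0 : 0 <= `|e| by [].
  lra.
have Ou : \forall e \near (0 : R)^', Om u by exact: nearW.
pose L := - (dotp xi u * g u / (Psi_t Psi u (f u) * f u ^+ 2)).
pose qa e := (dotp xi u / fe e u - dotp xi u / f u) / e.
pose qb e := (dotp xi (v e) / fe e (v e) - dotp xi (v e) / f (v e)) / e.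
have A : qa e @[e --> 0^'] --> L.
  exact: (perturbation_quotient_cvg Omu Ou (cvg_cst u)).
have B : qb e @[e --> 0^'] --> L by exact: (perturbation_quotient_cvg Omu Omv vu).
have f0 : f u != 0 by rewrite gt_eqF// f_pos.
have P0 : Psi_t Psi u (f u) != 0.
  apply/eqP => E; have := Psi_t_sign (Om_sph Omu) (f_pos Omu).
  by rewrite E mulr0 ltxx.
have LE : m xi * g u / (Psi_t Psi u (f u) * f u) =
    dotp xi u * g u / (Psi_t Psi u (f u) * f u ^+ 2).
  by rewrite mu; field; rewrite f0 P0.
rewrite LE -/L.
have AB : `|qa e - L| + `|qb e - L| @[e --> 0^'] --> 0.
  have dist0 (h : R -> R) : h e @[e --> 0^'] --> L -> `|h e - L| @[e --> 0^'] --> 0.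
    by move=> /subr_cvg0 H; apply/norm_cvg0P.
  by have := cvgD (dist0 _ A) (dist0 _ B); rewrite addr0; exact.
apply/subr_cvg0/norm_cvg0P.
apply: (@squeeze_cvgr _ _ _ _ (fun=> 0) (fun e => `|qa e - L| + `|qb e - L|)) => //;
  last exact: cvg_cst.
near=> e; rewrite normr_ge0/=.
have ed : `|e| < d1 by near: e.
have e0 : e != 0 by near: e; exact: nbhs_dnbhs_neq.
have ed' := lt_le_trans ed d1d.
have [Ov mv] := vP e ed.
have Hu := wulff_gauge_ge n0 Om_sph Om_closed Om_nhemi (fe_cont ed') (fe_pos ed') xi Omu.
have Hv := wulff_gauge_ge n0 Om_sph Om_closed Om_nhemi f_cont f_pos xi Ov.
set X := (me e xi - m xi) / e.
(* [u] competes in the perturbed maximum and [v e] in the unperturbed one, which bounds the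
   increment from both sides; dividing by a negative [e] reverses the order. *)
have between : qa e <= X <= qb e \/ qb e <= X <= qa e.
  have [e_gt0|e_lt0|e_eq0] := ltgtP 0 e.
  - left; rewrite /qa /qb /X !ler_pM2r ?invr_gt0//; apply/andP; split; lra.
  - right; rewrite /qa /qb /X !ler_nM2r ?invr_lt0//; apply/andP; split; lra.
  - by move: e0; rewrite -e_eq0 eqxx.
have := ler_norm (qa e - L); have := ler_norm (qb e - L).
have := ler_norm (- (qa e - L)); have := ler_norm (- (qb e - L)); rewrite !normrN.
have := normr_ge0 (qa e - L); have := normr_ge0 (qb e - L).
move=> ? ? ? ? ? ?.
by rewrite ler_norml; case: between => /andP[? ?]; apply/andP; split; lra.
Unshelve. all: by end_near. Qed.

(** By the chain rule the derivative of $m^{-n}$ is $n\,m^{-n}g/(f\Psi_t)$ at the normal; as $h_K=f$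
    there, this is $n\,g$ times the density of $S_\Psi$. *)
Lemma radial_pow_derivative xi : wulff_regular Om f xi ->
  ((me e xi)^-1 ^+ n - (m xi)^-1 ^+ n) / e @[e --> 0^'] -->
    n%:R * (g (alphaK K xi) * SPsi_density Psi K xi).
Proof.
move=> Rxi; have Sxi : sphere xi by case: Rxi.
have [Omu _ mu hu _] := wulff_regularP n0 Om_sph Om_closed Om_nhemi f_cont f_pos Rxi.
have m0 := wulff_gauge_gt0 n0 Om_sph Om_closed Om_nhemi f_cont f_pos (sphere_neq0 Sxi).
have D := gauge_perturbation_derivative Rxi.
rewrite /SPsi_density hu (radial_wulff n0 Om_sph Om_closed Om_nhemi f_cont f_pos Sxi).
set u := alphaK K xi in Omu mu hu D *; set p := Psi_t Psi u (f u) in D *.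
have f0 : f u != 0 by rewrite gt_eqF// f_pos.
have p0 : p != 0.
  apply/eqP => E; have := Psi_t_sign (Om_sph Omu) (f_pos Omu).
  by rewrite -/p E mulr0 ltxx.
have mxi0 : m xi != 0 by rewrite gt_eqF.
have mc := gauge_perturbation_cvg Sxi.
have mV : (me e xi)^-1 @[e --> 0^'] --> (m xi)^-1 by exact: cvgV.
rewrite (_ : n%:R * _ = n%:R * (m xi)^-1 ^+ n * (((m xi)^-1 * g u / (p * f u)) / (m xi)^-1)).
  apply: cvg_difference_quotientX => //; first by rewrite invr_eq0.
  rewrite (_ : _ * _ / _ = - (- (m xi * g u / (p * f u)) / (m xi * m xi))).
    apply: (@cvg_trans _ ((fun e => - ((me e xi - m xi) / e / (me e xi * m xi))) @ 0^')).
      apply: near_eq_cvg; near=> e.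
      have e0 : e != 0 by near: e; exact: nbhs_dnbhs_neq.
      have me0 : me e xi != 0 by near: e; exact: cvgr_neq0 mc _.
      by field; rewrite e0 me0 mxi0.
    have mm0 : m xi * m xi != 0 by rewrite mulf_neq0.
    exact: (cvgN (cvgM D (cvgV mm0 (cvgM mc (cvg_cst (m xi)))))).
  by field; rewrite mxi0 f0 p0.
by field; rewrite mxi0 f0 p0.
Unshelve. all: by end_near. Qed.

(** Supplies the constant that dominates the difference quotients. *)
Lemma radial_pow_lipschitz : exists C d1 : R, [/\ 0 <= C, 0 < d1 <= d &
  forall e xi, `|e| < d1 -> sphere xi ->
    `|(me e xi)^-1 ^+ n - (m xi)^-1 ^+ n| <= C * `|e|].
Proof.
have [C [d1 [C0 /andP[d10 d1d] _ mC]]] := gauge_perturbation_lipschitz.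
have [c [M [c0 cM cm]]] := gauge_bounds
  (wulff_gauge_continuous n0 Om_sph Om_closed Om_nhemi f_cont f_pos)
  (wulff_gauge_gt0 n0 Om_sph Om_closed Om_nhemi f_cont f_pos).
have c20 : 0 < c / 2 by lra.
have [D D0 lipD] := @exprn_lipschitz R n (c / 2)^-1 (ltac:(by rewrite invr_ge0 ltW)).
(* Keeps the perturbed gauges above [c / 2] on the sphere, so that inversion and powers are
   Lipschitz. *)
pose d2 := Num.min d1 (c / 2 / (C + 1)).
exists (D * (C / (c / 2 * (c / 2)))), d2; split.
- by rewrite mulr_ge0// divr_ge0// mulr_ge0// ltW.
- rewrite lt_min d10 ge_min d1d/= andbT; rewrite divr_gt0// ltr_pwDr//.
move=> e xi; rewrite lt_min => /andP[ed]; rewrite ltr_pdivlMr ?ltr_pwDr// => eC Sxi.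
have /andP[cxi _] := cm xi Sxi.
have mCe := mC e xi ed Sxi.
have e0 : 0 <= `|e| by [].
have mec : c / 2 <= me e xi.
  by move: mCe; rewrite ler_norml => /andP[? ?]; lra.
have mc : c / 2 <= m xi by lra.
have me0 : 0 < me e xi by lra.
have m0 : 0 < m xi by lra.
have lipabs x y : 0 <= x <= (c / 2)^-1 -> 0 <= y <= (c / 2)^-1 ->
    `|x ^+ n - y ^+ n| <= D * `|x - y|.
  move=> /andP[x0 xc] /andP[y0 yc]; have [xy|/ltW yx] := leP x y.
    rewrite distrC (distrC x) !ger0_norm ?subr_ge0 ?lipD//.
    by rewrite lerXn2r ?nnegrE.
  rewrite !ger0_norm ?subr_ge0 ?lipD//.
  by rewrite lerXn2r ?nnegrE.
apply: (le_trans (lipabs _ _ _ _)).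
- by rewrite invr_ge0 (ltW me0) lef_pV2.
- by rewrite invr_ge0 (ltW m0) lef_pV2.
rewrite -mulrA ler_wpM2l//.
rewrite (_ : _ - _ = (m xi - me e xi) / (me e xi * m xi)); last first.
  by field; rewrite !gt_eqF.
rewrite normrM normfV distrC (gtr0_norm (mulr_gt0 me0 m0)).
rewrite mulrAC; apply: ler_pM => //; first by rewrite invr_ge0 mulr_ge0// ltW.
by rewrite lef_pV2 ?posrE ?mulr_gt0// ler_pM// ltW.
Qed.

End Perturbation.

(** * Change of variables to the sphere *)

Section ChangeOfVariables.
Context {R : realType} {n : nat}.
Hypothesis n0 : (0 < n)%N.
Local Notation V := 'rV[R]_n.
Local Notation Sph := (@SphType R n).
Local Notation Borel := (@BorelType R n).
Local Notation sigma := (@sph_measure R n).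
Variable Psi : V -> R -> R.
Hypothesis Psi_t_cont : {within dom_St, continuous (fun p : V * R => Psi_t Psi p.1 p.2)}.
Variable s : R.
Hypothesis Psi_t_sign : forall xi t, sphere xi -> 0 < t -> 0 < s * Psi_t Psi xi t.
Variable Om : set V.
Hypotheses (Om_sph : Om `<=` sphere) (Om_closed : closed Om).
Hypothesis Om_nhemi : ~ in_closed_hemisphere Om.
Variable f : V -> R.
Hypotheses (f_cont : {within Om, continuous f}) (f_pos : forall xi, Om xi -> 0 < f xi).
Local Notation K := (wulff Om f).
Local Notation m := (wulff_gauge Om f).
Local Notation Rg := (wulff_regular Om f).
Local Notation alpha := (alphaK (wulff Om f)).

Let cOm := Om_compact Om_sph Om_closed.
Let regP := wulff_regularP n0 Om_sph Om_closed Om_nhemi f_cont f_pos.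

Lemma measurable_wulff_singular : measurable (wulff_singular Om f : set Sph).
Proof.
by apply: sph_measure_null_measurable; exact: wulff_singular_null.
Qed.

Lemma measurable_wulff_regular : measurable (Rg : set Sph).
Proof.
apply: (@measurableD _ Sph); first exact: sph_measurable_sphere.
exact: measurable_wulff_singular.
Qed.

Lemma measurable_fun_regular (h : V -> R) : {within Rg, continuous h} ->
  measurable_fun (Rg : set Sph) h.
Proof.
exact: (@within_continuous_measurable _ Sph V id (sph_measurable_open n0)
  R Rg h measurable_wulff_regular).
Qed.

Lemma measurable_fun_alphaK : measurable_fun (Rg : set Sph) (alpha : Sph -> Borel).
Proof.
apply: (@measurability _ _ Sph Borel _ _ [set A : set V | open A] erefl).
move=> _ [U oU <-].
have [W oW ->] := within_continuous_preimage
  (alphaK_continuous n0 Om_sph Om_closed Om_nhemi f_cont f_pos) oU.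
apply: measurableI; first exact: measurable_wulff_regular.
exact: (sph_measurable_open n0 oW).
Qed.

Lemma borel_measurable_Om : measurable (Om : set Borel).
Proof.
rewrite -[Om]setCK; apply: (@measurableC _ Borel); apply: sub_sigma_algebra.
exact: closed_openC.
Qed.

Lemma borel_measurable_fun (h : V -> R) : {within Om, continuous h} ->
  measurable_fun (Om : set Borel) h.
Proof.
apply: (@within_continuous_measurable _ Borel V id _ R Om h borel_measurable_Om).
by move=> U oU; exact: sub_sigma_algebra.
Qed.

Lemma regular_comp_continuous (h : V -> R) : {within Om, continuous h} ->
  {within Rg, continuous (h \o alpha)}.
Proof.
move=> hc; apply/subspace_continuousP => xi Rxi.
have [Oa _ _ _ _] := regP Rxi.
apply: (within_continuous_cvg hc Oa).
  by move/subspace_continuousP :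
    (alphaK_continuous n0 Om_sph Om_closed Om_nhemi f_cont f_pos); apply.
by apply: filterS (withinT Rg (nbhs_filter xi)) => eta /regP[].
Qed.

Lemma SPsi_density_regular xi : Rg xi -> SPsi_density Psi K xi =
  (m xi)^-1 ^+ n / (f (alpha xi) * Psi_t Psi (alpha xi) (f (alpha xi))).
Proof.
move=> Rxi; have [_ _ _ hu _] := regP Rxi.
by rewrite /SPsi_density hu (radial_wulff n0)//; case: Rxi.
Qed.

Lemma Psi_t_f_continuous : {within Om, continuous (fun u => Psi_t Psi u (f u))}.
Proof.
apply/subspace_continuousP => u Omu.
have fu : f eta @[eta --> within Om (nbhs u)] --> f u.
  by move/subspace_continuousP : f_cont; apply.
have uu : id eta @[eta --> within Om (nbhs u)] --> u by exact: cvg_within.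
apply: (@within_continuous_cvg _ _ dom_St (fun p : V * R => Psi_t Psi p.1 p.2)
  (u, f u) _ _ _ (fun eta => (eta, f eta)) Psi_t_cont).
- by split; [exact: Om_sph|exact: f_pos].
- exact: (cvg_pair uu fu).
- apply: filterS (withinT Om (nbhs_filter u)) => eta Oe.
  by split; [exact: Om_sph|exact: f_pos].
Qed.

Lemma Psi_t_f_neq0 u : Om u -> Psi_t Psi u (f u) != 0.
Proof.
move=> Omu; apply/eqP => E; have := Psi_t_sign (Om_sph Omu) (f_pos Omu).
by rewrite E mulr0 ltxx.
Qed.

Lemma measurable_fun_SPsi_density :
  measurable_fun (Rg : set Sph) (SPsi_density Psi K : Sph -> R).
Proof.
pose h u := (f u * Psi_t Psi u (f u))^-1.
have hc : {within Om, continuous h}.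
  apply/subspace_continuousP => u Omu.
  have fu : f eta @[eta --> within Om (nbhs u)] --> f u.
    by move/subspace_continuousP : f_cont; apply.
  have pu : Psi_t Psi eta (f eta) @[eta --> within Om (nbhs u)] --> Psi_t Psi u (f u).
    by move/subspace_continuousP : Psi_t_f_continuous; apply.
  have fp0 : f u * Psi_t Psi u (f u) != 0.
    by rewrite mulf_neq0 ?Psi_t_f_neq0// gt_eqF// f_pos.
  exact: (cvgV fp0 (cvgM fu pu)).
have mh := measurable_fun_regular (regular_comp_continuous hc).
have mc : {within Rg, continuous (fun xi => (m xi)^-1)}.
  apply: continuous_in_subspaceT => xi; rewrite inE => -[/sphere_neq0 xi0 _].
  have mx0 : m xi != 0.
    by rewrite gt_eqF// (wulff_gauge_gt0 n0 Om_sph Om_closed Om_nhemi f_cont f_pos).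
  exact: (cvgV mx0 (@wulff_gauge_continuous _ _ n0 _ Om_sph Om_closed Om_nhemi _
    f_cont f_pos xi)).
have mm := measurable_funX n (measurable_fun_regular mc).
apply: (@eq_measurable_fun _ _ Sph R (Rg : set Sph)
  (fun xi => (m xi)^-1 ^+ n * h (alpha xi))).
  by move=> xi; rewrite inE => /SPsi_density_regular ->.
exact: measurable_funM mm mh.
Qed.

Lemma SPsi_density_bounded : exists M : R, forall xi, Rg xi ->
  `|SPsi_density Psi K xi| <= M.
Proof.
have [a [b [a0 ab fab]]] := positive_bounds n0 Om_sph Om_closed Om_nhemi f_cont f_pos.
have [c c0 cP] := Psi_t_lower_bound n0 Psi_t_cont Psi_t_sign Om_sph Om_closed
  Om_nhemi a0 ab.
have [c' [M' [c'0 _ cm]]] := gauge_bounds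
  (wulff_gauge_continuous n0 Om_sph Om_closed Om_nhemi f_cont f_pos)
  (wulff_gauge_gt0 n0 Om_sph Om_closed Om_nhemi f_cont f_pos).
exists (c'^-1 ^+ n * (a^-1 * (`|s| / c))) => xi Rxi.
have [Oa _ _ _ _] := regP Rxi; rewrite SPsi_density_regular//.
have Sxi : sphere xi by case: Rxi.
have /andP[cxi _] := cm xi Sxi.
have /andP[fa fb] := fab _ Oa.
have cPa := cP _ (f (alpha xi)) Oa (fab _ Oa).
set p := Psi_t _ _ _ in cPa *.
have p0 : p != 0 by exact: Psi_t_f_neq0.
rewrite normrM ler_pM//.
  rewrite normrX lerXn2r ?nnegrE ?invr_ge0 ?(ltW c'0)//.
  rewrite normfV gtr0_norm; last exact: lt_le_trans cxi.
  by rewrite lef_pV2// posrE// (lt_le_trans c'0).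
rewrite normfV normrM invfM ler_pM ?invr_ge0//.
  rewrite gtr0_norm; last exact: lt_le_trans fa.
  by rewrite lef_pV2// posrE// (lt_le_trans a0).
rewrite ler_pdivlMr// -ler_pdivlMl ?invr_gt0 ?normr_gt0// invrK mulrC -normrM.
exact: le_trans cPa (ler_norm _).
Qed.

Lemma sph_lty (A : set Sph) : (sigma A < +oo)%E.
Proof. exact: sph_measure_lty. Qed.

Lemma integrable_regular (h : Sph -> R) (M : R) (A : set Sph) :
  measurable_fun (Rg : set Sph) h -> (forall xi, Rg xi -> `|h xi| <= M) ->
  measurable A -> A `<=` Rg -> sigma.-integrable A (EFin \o h).
Proof.
move=> mh hM mA AR; apply: (@bounded_integrable _ _ _ _ _ _ M) => //.
- exact: sph_lty.
- exact: measurable_funS measurable_wulff_regular AR mh.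
- by move=> xi /AR; exact: hM.
Qed.

Lemma measurable_alpha_preimage (om : set Borel) : measurable om ->
  measurable (Rg `&` alpha @^-1` om : set Sph).
Proof. by move=> mom; apply: measurable_fun_alphaK => //; exact: measurable_wulff_regular. Qed.

(** At a regular direction [alphaK] is the only normal, so [alpha_star] becomes a preimage; its
    other directions are singular, hence null. *)
Lemma SPsi_regular (om : set Borel) : measurable om ->
  SPsi Psi K om = (\int[sigma]_(xi in (Rg `&` alpha @^-1` om : set Sph))
    (SPsi_density Psi K xi)%:E)%E.
Proof.
move=> mom; have mA := measurable_alpha_preimage mom.
pose B : set Sph := alpha_star K om `&` wulff_singular Om f.
have B0 : sigma B = 0%E.
  apply/eqP; rewrite eq_le measure_ge0 andbT.
  rewrite -(wulff_singular_null n0 Om_sph Om_closed Om_nhemi f_cont f_pos).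
  by apply: (@le_outer_measure _ _ (@sph_om R n)) => x [].
have mB : measurable B by exact: sph_measure_null_measurable.
(* Nothing is known of the density on [B], but all subsets of this null set are measurable. *)
have mDB : measurable_fun B (fun xi => (SPsi_density Psi K xi)%:E).
  move=> _ Y _; apply: sph_measure_null_measurable.
  apply/eqP; rewrite eq_le measure_ge0 andbT -B0.
  by apply: (@le_outer_measure _ _ (@sph_om R n)) => x [].
have mDA : measurable_fun (Rg `&` alpha @^-1` om : set Sph)
    (fun xi => (SPsi_density Psi K xi)%:E).
  apply/measurable_EFinP; apply: measurable_funS measurable_fun_SPsi_density.
    exact: measurable_wulff_regular.
  by move=> ? [].
rewrite /SPsi (_ : alpha_star K om = (Rg `&` alpha @^-1` om) `|` B).
  have dAB : [disjoint Rg `&` alpha @^-1` om & B].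
    by apply/eqP; apply/seteqP; split => // xi [[[_ Nxi] _] [_ /Nxi]].
  rewrite (integral_setU sigma mA mB ((measurable_funU _ mA mB).2 (conj mDA mDB)) dAB).
  by rewrite (null_set_integral mB mDB B0) adde0.
apply/seteqP; split=> xi.
  move=> axi; have [Nxi|Nxi] := pselect (wulff_singular Om f xi); first by right.
  have [Sxi [u xu omu]] := axi; have Rxi : Rg xi by [].
  left; split => //; have [_ E _ _ _] := regP Rxi.
  by move: xu omu; rewrite E => ->.
case=> [[Rxi omxi]|[]//]; split; first by case: Rxi.
by exists (alpha xi) => //; have [_ -> _ _ _] := regP Rxi.
Qed.

Variables (mup mun : {measure set Borel -> \bar R}).
Hypotheses (mup_fin : (mup (Om : set Borel) < +oo)%E)
  (mun_fin : (mun (Om : set Borel) < +oo)%E).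
Hypothesis HS : forall om : set Borel, measurable om -> om `<=` Om ->
  SPsi Psi K om = (mup om - mun om)%E.
Variable g : V -> R.
Hypothesis g_cont : {within Om, continuous g}.

Lemma integrable_Om (mu : {measure set Borel -> \bar R}) (A : set Borel) :
  (mu (Om : set Borel) < +oo)%E -> measurable A -> A `<=` Om ->
  (mu A < +oo)%E /\ mu.-integrable A (EFin \o (g : Borel -> R)).
Proof.
move=> muOm mA AO; have muA : (mu A < +oo)%E.
  apply: le_lt_trans muOm; apply: le_measure => //; rewrite inE//.
  exact: borel_measurable_Om.
split => //.
have [M M0 gM] : exists2 M : R, 0 < M & forall y, (g @` Om) y -> `|y| <= M.
  have /compact_bounded/ex_strict_bound_gt0[M M0 BM] := continuous_compact g_cont cOm.
  by exists M => // y gy; exact/ltW/BM.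
apply: (@bounded_integrable _ _ _ _ _ _ M) => //.
  exact: measurable_funS borel_measurable_Om AO (borel_measurable_fun g_cont).
by move=> u /AO Ou; apply: gM; exists u.
Qed.

(** On the directions whose normal lies in a level set $\{x\le g<y\}$, replacing [g] by [x] changes
    the three integrals by at most $y-x$ times $\int|D|$, [mup] and [mun] respectively. After the
    replacement they agree by [HS]. The absolute value is needed because [D] has the sign of
    $\Psi_t$. *)
Lemma Rintegral_alphaK :
  Rintegral sigma (Rg : set Sph) (fun xi => g (alpha xi) * SPsi_density Psi K xi) =
  Rintegral mup (Om : set Borel) g - Rintegral mun (Om : set Borel) g.
Proof.
have [G G0 gG] : exists2 G : R, 0 < G & forall u, Om u -> `|g u| <= G.
  have /compact_bounded/ex_strict_bound_gt0[M M0 BM] := continuous_compact g_cont cOm.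
  by exists M => // u Ou; apply/ltW/BM; exists u.
have [M DM] := SPsi_density_bounded.
set D := SPsi_density Psi K.
pose w (x y : R) : set Borel := [set u | Om u /\ x <= g u < y].
pose A (x y : R) : set Sph := Rg `&` alpha @^-1` (w x y).
have mw x y : measurable (w x y).
  rewrite (_ : w x y = Om `&` g @^-1` `[x, y[%classic).
    exact: (borel_measurable_fun g_cont borel_measurable_Om (measurable_itv _)).
  by apply/seteqP; split=> u /=; rewrite in_itv.
have wO x y : w x y `<=` Om by move=> u [].
have mA x y : measurable (A x y) by exact: measurable_alpha_preimage.
have AR x y : A x y `<=` Rg by move=> u [].
have mga : measurable_fun (Rg : set Sph) (g \o alpha).
  exact: measurable_fun_regular (regular_comp_continuous g_cont).
have mD := measurable_fun_SPsi_density.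
have iD x y : sigma.-integrable (A x y) (EFin \o D).
  exact: integrable_regular mD DM (mA x y) (AR x y).
have iaD x y : sigma.-integrable (A x y) (EFin \o (fun xi => `|D xi|)).
  apply: (integrable_regular (M := M) _ _ (mA x y) (AR x y)).
    exact: (measurableT_comp (@normr_measurable R setT) mD).
  by move=> xi Rxi; rewrite normr_id DM.
pose gD (xi : Sph) := g (alpha xi) * D xi.
have igD x y : sigma.-integrable (A x y) (EFin \o gD).
  apply: (integrable_regular (M := G * M) (measurable_funM mga mD) _ (mA x y) (AR x y)).
  move=> xi Rxi; rewrite normrM ler_pM ?DM// gG//.
  by have [] := regP Rxi.
have wadd x y z : x <= y -> y <= z -> w x z = w x y `|` w y z.
  move=> xy yz; apply/seteqP; split=> u.
    move=> [Ou /andP[xu uz]]; have [uy|yu] := ltP (g u) y.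
      by left; split => //; rewrite xu.
    by right; split => //; rewrite yu.
  case=> -[Ou /andP[u1 u2]]; split => //.
    by rewrite u1 (lt_le_trans u2).
  by rewrite u2 (le_trans xy).
have wdisj x y z : [disjoint w x y & w y z].
  apply/eqP; apply/seteqP; split=> u // -[[_ /andP[_ u1]] [_ /andP[u2 _]]].
  by have := le_lt_trans u2 u1; rewrite ltxx.
have Aadd x y z : x <= y -> y <= z -> A x z = A x y `|` A y z.
  by move=> xy yz; rewrite /A (wadd x y z)// preimage_setU setIUr.
have Adisj x y z : [disjoint A x y & A y z].
  apply/eqP; apply/seteqP; split=> u // -[[_ u1] [_ u2]].
  have /eqP H := wdisj x y z.
  by have : (w x y `&` w y z) (alpha u) by []; rewrite H.
have ip x y := integrable_Om mup_fin (mw x y) (wO x y).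
have iq x y := integrable_Om mun_fin (mw x y) (wO x y).
have HSw x y : Rintegral sigma (A x y) D = fine (mup (w x y)) - fine (mun (w x y)).
  rewrite /Rintegral -(SPsi_regular (mw x y)) HS// fineB//.
    by rewrite ge0_fin_numE//; case: (ip x y).
  by rewrite ge0_fin_numE//; case: (iq x y).
(* The level sets are half-open, so the upper end must exceed the bound [G] of [g]. *)
have OmE : Om = w (- G) (G + 1).
  apply/seteqP; split=> u; last by case.
  move=> Ou; split => //; have := gG u Ou; rewrite ler_norml => /andP[-> gu].
  by rewrite (le_lt_trans gu)// ltrDl.
have RE : Rg = A (- G) (G + 1).
  apply/seteqP; split=> xi; last by case.
  move=> Rxi; split => //; rewrite -OmE /=; have [] := regP Rxi => //.
have -> : Rintegral sigma (Rg : set Sph) (fun xi => g (alpha xi) * D xi) =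
    Rintegral sigma (A (- G) (G + 1)) gD by rewrite -RE.
have Om_w (mu : {measure set Borel -> \bar R}) :
    Rintegral mu (Om : set Borel) g = Rintegral mu (w (- G) (G + 1)) g.
  by rewrite -OmE.
rewrite !Om_w; apply/eqP; rewrite -subr_eq0; apply/eqP.
apply: (@additive_interval_eq0 _
  (fun x y => Rintegral sigma (A x y) gD -
    (Rintegral mup (w x y) g - Rintegral mun (w x y) g))
  (fun x y => Rintegral sigma (A x y) (fun xi => `|D xi|) +
    (fine (mup (w x y)) + fine (mun (w x y)))) (- G) (G + 1)).
- lra.
- move=> x y z _ xy yz _.
  have -> : Rintegral sigma (A x z) gD =
      Rintegral sigma (A x y) gD + Rintegral sigma (A y z) gD.
    have := igD x z; rewrite (Aadd x y z xy yz) => i.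
    exact: (Rintegral_setU (mA x y) (mA y z) i (Adisj x y z)).
  have := (ip x z).2; have := (iq x z).2; rewrite (wadd x y z xy yz) => iqz ipz.
  rewrite (Rintegral_setU (mw x y) (mw y z) ipz (wdisj x y z)).
  by rewrite (Rintegral_setU (mw x y) (mw y z) iqz (wdisj x y z)); ring.
- move=> x y z _ xy yz _.
  have -> : Rintegral sigma (A x z) (fun xi => `|D xi|) =
      Rintegral sigma (A x y) (fun xi => `|D xi|) +
      Rintegral sigma (A y z) (fun xi => `|D xi|).
    have := iaD x z; rewrite (Aadd x y z xy yz) => i.
    exact: (Rintegral_setU (mA x y) (mA y z) i (Adisj x y z)).
  rewrite (wadd x y z xy yz).
  rewrite (fine_measureU (mw x y) (mw y z) (ip x y).1 (ip y z).1 (wdisj x y z)).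
  rewrite (fine_measureU (mw x y) (mw y z) (iq x y).1 (iq y z).1 (wdisj x y z)).
  by ring.
- move=> x y _ xy _.
  have gb u : w x y u -> x <= g u <= y by move=> [_ /andP[-> /ltW]].
  have /andP[p1 p2] := Rintegral_between (mw x y) (ip x y).1 (ip x y).2 gb.
  have /andP[q1 q2] := Rintegral_between (mw x y) (iq x y).1 (iq x y).2 gb.
  have E : `|Rintegral sigma (A x y) gD - x * Rintegral sigma (A x y) D| <=
      (y - x) * Rintegral sigma (A x y) (fun xi => `|D xi|).
    have mxD : measurable_fun (Rg : set Sph) (fun xi : Sph => x * D xi).
      exact: (measurable_funM (measurable_cst x) mD).
    have mdD : measurable_fun (Rg : set Sph) (fun xi : Sph => gD xi - x * D xi).
      exact: (measurable_funB (measurable_funM mga mD) mxD).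
    have bdD xi : Rg xi -> `|gD xi - x * D xi| <= G * M + `|x| * M.
      move=> Rxi; have [Oa _ _ _ _] := regP Rxi.
      rewrite (le_trans (ler_normB _ _))// /gD (normrM (g _)) (normrM x) lerD//.
        by apply: ler_pM => //; [exact: gG|exact: DM].
      by rewrite ler_wpM2l// DM.
    have ixD : sigma.-integrable (A x y) (EFin \o (fun xi => x * D xi)).
      apply: (integrable_regular (M := `|x| * M) mxD _ (mA x y) (AR x y)).
      by move=> xi Rxi; rewrite normrM ler_wpM2l// DM.
    have idD : sigma.-integrable (A x y) (EFin \o (fun xi => gD xi - x * D xi)).
      exact: (integrable_regular mdD bdD (mA x y) (AR x y)).
    have idaD : sigma.-integrable (A x y) (EFin \o (fun xi => `|gD xi - x * D xi|)).
      apply: (integrable_regular (M := G * M + `|x| * M) _ _ (mA x y) (AR x y)).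
        exact: (measurableT_comp (@normr_measurable R setT) mdD).
      by move=> xi Rxi; rewrite normr_id bdD.
    have iyD : sigma.-integrable (A x y) (EFin \o (fun xi => (y - x) * `|D xi|)).
      apply: (integrable_regular (M := `|y - x| * M) _ _ (mA x y) (AR x y)).
        apply: (measurable_funM (measurable_cst (y - x))).
        exact: (measurableT_comp (@normr_measurable R setT) mD).
      by move=> xi Rxi; rewrite normrM ler_wpM2l// normr_id DM.
    rewrite -(RintegralZl x (mA x y) (iD x y)) -(RintegralB (mA x y) (igD x y) ixD).
    rewrite -(RintegralZl (y - x) (mA x y) (iaD x y)).
    apply: (le_trans (le_normr_Rintegral (mA x y) idD)).
    apply: (le_Rintegral (mA x y) idaD iyD) => xi [_ /gb /andP[xg gy]].
    rewrite /gD -mulrBl normrM ler_wpM2r//.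
    by rewrite ger0_norm ?subr_ge0// lerD2r.
  rewrite HSw in E.
  have P0 : 0 <= fine (mup (w x y)) by rewrite fine_ge0.
  have N0 : 0 <= fine (mun (w x y)) by rewrite fine_ge0.
  have P1 : 0 <= (y - x) * fine (mup (w x y)) by rewrite mulr_ge0// subr_ge0.
  have N1 : 0 <= (y - x) * fine (mun (w x y)) by rewrite mulr_ge0// subr_ge0.
  move: E; rewrite !ler_norml => /andP[E1 E2].
  rewrite mulrDr mulrDr; rewrite mulrBr in E1 E2; rewrite mulrBl in P1 N1 *.
  apply/andP; split; lra.
Qed.

End ChangeOfVariables.

(** * The variational formula *)

Section VolumeOverRegular.
Context {R : realType} {n : nat}.
Hypothesis n0 : (0 < n)%N.
Local Notation V := 'rV[R]_n.
Local Notation Sph := (@SphType R n).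
Local Notation sigma := (@sph_measure R n).
Variable Om : set V.
Hypotheses (Om_sph : Om `<=` sphere) (Om_closed : closed Om).
Hypothesis Om_nhemi : ~ in_closed_hemisphere Om.
Variables f h : V -> R.
Hypotheses (f_cont : {within Om, continuous f}) (f_pos : forall xi, Om xi -> 0 < f xi).
Hypotheses (h_cont : {within Om, continuous h}) (h_pos : forall xi, Om xi -> 0 < h xi).

Lemma integrable_gauge_powV :
  sigma.-integrable (sphere : set Sph) (EFin \o (fun xi => (wulff_gauge Om h xi)^-1 ^+ n)).
Proof.
have hc := wulff_gauge_continuous n0 Om_sph Om_closed Om_nhemi h_cont h_pos.
have hp := wulff_gauge_gt0 n0 Om_sph Om_closed Om_nhemi h_cont h_pos.
have [c [M [c0 _ cm]]] := gauge_bounds hc hp.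
have cV : {within sphere, continuous (fun xi => (wulff_gauge Om h xi)^-1)}.
  apply: continuous_in_subspaceT => xi; rewrite inE => /sphere_neq0 xi0.
  have mx0 : wulff_gauge Om h xi != 0 by rewrite gt_eqF// hp.
  exact: (cvgV mx0 (@hc xi)).
have mV := @within_continuous_measurable _ Sph V id (sph_measurable_open n0)
  R sphere _ (sph_measurable_sphere n0) cV.
apply: (@bounded_integrable _ _ _ _ _ _ (c^-1 ^+ n) (sph_measurable_sphere n0)
  (sph_measure_lty n0 _) (measurable_funX n mV)).
move=> xi Sxi; have /andP[cxi _] := cm xi Sxi.
have m0 := hp _ (sphere_neq0 Sxi).
rewrite normrX lerXn2r ?nnegrE ?invr_ge0 ?(ltW c0)//.
by rewrite normfV gtr0_norm// lef_pV2.
Qed.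

(** The domain is the regular set of [f], whatever [h] is: all perturbed volumes become integrals
    over one set, on which the pointwise derivative is available. *)
Lemma volume_wulff : volume (wulff Om h) = n%:R^-1 *
  Rintegral sigma (wulff_regular Om f : set Sph)
    (fun xi => (wulff_gauge Om h xi)^-1 ^+ n).
Proof.
have hc := wulff_gauge_continuous n0 Om_sph Om_closed Om_nhemi h_cont h_pos.
have hp := wulff_gauge_gt0 n0 Om_sph Om_closed Om_nhemi h_cont h_pos.
have hZ := wulff_gaugeZ n0 Om_sph Om_closed Om_nhemi h_cont h_pos.
rewrite (wulffE n0 Om_sph Om_closed Om_nhemi h_cont h_pos).
rewrite (volume_polar n0 hc hZ hp); congr (_ * fine _).
apply: negligible_integral.
- exact: (measurable_wulff_singular n0 Om_sph Om_closed Om_nhemi f_cont f_pos).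
- exact: sph_measurable_sphere.
- exact: integrable_gauge_powV.
- exact: (wulff_singular_null n0 Om_sph Om_closed Om_nhemi f_cont f_pos).
Qed.

End VolumeOverRegular.

(** Since $S_\Psi$ is negative for [class_Cd], integration against it is expressed by two measures
    finite on [Om] whose difference is [SPsi] on the Borel subsets of [Om]. *)
Theorem theorem4p4 (R : realType) (n : nat) (hn : (2 <= n)%N)
  (Psi : 'rV[R]_n -> R -> R) (HPsi : class_CI Psi \/ class_Cd Psi)
  (Om : set 'rV[R]_n) (Om_sph : Om `<=` sphere) (Om_closed : closed Om)
  (Om_nhemi : ~ in_closed_hemisphere Om)
  (f g : 'rV[R]_n -> R)
  (f_cont : {within Om, continuous f}) (f_pos : forall xi, Om xi -> 0 < f xi)
  (g_cont : {within Om, continuous g})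
  (fe : R -> 'rV[R]_n -> R)
  (Hfe : exists2 d : R, 0 < d & forall e : R, `|e| < d ->
     {within Om, continuous fe e} /\
     (forall xi, Om xi ->
        0 < fe e xi /\ Psi xi (fe e xi) = Psi xi (f xi) + e * g xi))
  (mup mun : {measure set (@BorelType R n) -> \bar R})
  (mup_fin : (mup (Om : set BorelType) < +oo)%E)
  (mun_fin : (mun (Om : set BorelType) < +oo)%E)
  (HS : forall om : set (@BorelType R n), measurable om -> om `<=` Om ->
     SPsi Psi (wulff Om f) om = (mup om - mun om)%E) :
  exists2 L : R,
    (fun e : R => (volume (wulff Om (fe e)) - volume (wulff Om f)) / e)
      @ 0^' --> L
  & L%:E = (\int[mup]_(u in (Om : set BorelType)) (g u)%:E
            - \int[mun]_(u in (Om : set BorelType)) (g u)%:E)%E.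
Proof.
have n0 : (0 < n)%N by exact: ltnW.
have [Psi_der Psi_t_cont] : (forall xi t, sphere xi -> 0 < t -> derivable (Psi xi) t 1) /\
    {within dom_St, continuous (fun p : 'rV[R]_n * R => Psi_t Psi p.1 p.2)}.
  by case: HPsi => -[[]].
have [s Psi_t_sign] : exists s : R, forall xi t, sphere xi -> 0 < t ->
    0 < s * Psi_t Psi xi t.
  case: HPsi => -[_ sgn]; [exists 1|exists (-1)] => xi t Sxi t0.
    by rewrite mul1r sgn.
  by rewrite mulN1r oppr_gt0 sgn.
have [d d0 Hd] := Hfe.
have fe_cont e : `|e| < d -> {within Om, continuous fe e} by move=> /Hd[].
have fe_pos e : `|e| < d -> forall xi, Om xi -> 0 < fe e xi.
  by move=> /Hd[_ H] xi /H[].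
have feE e : `|e| < d -> forall xi, Om xi -> Psi xi (fe e xi) = Psi xi (f xi) + e * g xi.
  by move=> /Hd[_ H] xi /H[].
pose Rg : set (@SphType R n) := wulff_regular Om f.
have mRg : measurable Rg.
  exact: (measurable_wulff_regular n0 Om_sph Om_closed Om_nhemi f_cont f_pos).
pose F (h : 'rV[R]_n -> R) (xi : @SphType R n) := (wulff_gauge Om h xi)^-1 ^+ n.
have [_ ip] := integrable_Om Om_sph Om_closed g_cont mup_fin
  (borel_measurable_Om Om_closed) (@subset_refl _ Om).
have [_ iq] := integrable_Om Om_sph Om_closed g_cont mun_fin
  (borel_measurable_Om Om_closed) (@subset_refl _ Om).
have IE := Rintegral_alphaK n0 Psi_t_cont Psi_t_sign Om_sph Om_closed Om_nhemi
  f_cont f_pos mup_fin mun_fin HS g_cont.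
exists (Rintegral mup (Om : set BorelType) g - Rintegral mun (Om : set BorelType) g); last first.
  have fp : (\int[mup]_(u in (Om : set BorelType)) (g u)%:E)%E \is a fin_num.
    by apply: integrable_fin_num => //; exact: borel_measurable_Om.
  have fq : (\int[mun]_(u in (Om : set BorelType)) (g u)%:E)%E \is a fin_num.
    by apply: integrable_fin_num => //; exact: borel_measurable_Om.
  by rewrite EFinB /Rintegral (fineK fp) (fineK fq).
rewrite -IE.
have iF (h : 'rV[R]_n -> R) : {within Om, continuous h} -> (forall xi, Om xi -> 0 < h xi) ->
    sph_measure.-integrable Rg (EFin \o F h).
  move=> hc hp; apply: integrableS mRg _ (integrable_gauge_powV n0 Om_sph Om_closed
    Om_nhemi hc hp); first exact: sph_measurable_sphere.
  by move=> ? [].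
have [C [d1 [C0 /andP[d10 d1d] FC]]] := radial_pow_lipschitz n0 Psi_der Psi_t_cont
  Psi_t_sign Om_sph Om_closed Om_nhemi f_cont f_pos g_cont d0 fe_cont fe_pos feE.
have F' xi (Rxi : Rg xi) := radial_pow_derivative n0 Psi_der Psi_t_cont
  Psi_t_sign Om_sph Om_closed Om_nhemi f_cont f_pos g_cont d0 fe_cont fe_pos feE Rxi.
pose q e (xi : @SphType R n) := n%:R^-1 * ((F (fe e) xi - F f xi) / e).
have nR0 : n%:R != 0 :> R by rewrite pnatr_eq0 -lt0n.
(* Dominated convergence applies to sequences, so the limit is tested along an arbitrary nonzero
   null sequence, shifted by [N] to stay within the radius [d1] of the uniform bounds. *)
apply/cvgr_dnbhsP => u [une0 u0].
have [N _ uN] : \forall k \near \oo, `|u k| < d1.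
  by move/cvgr0Pnorm_lt : u0; apply.
rewrite -(cvg_shiftn N).
have ud k : `|u (k + N)%N| < d1 by apply: uN; rewrite /= leq_addl.
have qE k : (volume (wulff Om (fe (u (k + N)%N))) - volume (wulff Om f)) / u (k + N)%N =
    Rintegral sph_measure Rg (q (u (k + N)%N)).
  have ud' := lt_le_trans (ud k) d1d.
  have i1 := iF _ (fe_cont _ ud') (fe_pos _ ud'); have i2 := iF _ f_cont f_pos.
  rewrite !(volume_wulff n0 Om_sph Om_closed Om_nhemi f_cont f_pos)//;
    [|exact: fe_cont|exact: fe_pos].
  have i3 := integrableB mRg i1 i2.
  rewrite -mulrBr -(RintegralB mRg i1 i2) -mulrA -(RintegralZr _ mRg i3).
  have i4 := integrableZr mRg (u (k + N)%N)^-1 i3.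
  by rewrite -(RintegralZl _ mRg i4).
under eq_fun do rewrite qE.
have Sxi xi : Rg xi -> sphere xi by case.
have mq k : measurable_fun Rg (q (u (k + N)%N)).
  have ud' := lt_le_trans (ud k) d1d.
  have /integrableP[/measurable_EFinP i1 _] := iF _ (fe_cont _ ud') (fe_pos _ ud').
  have /integrableP[/measurable_EFinP i2 _] := iF _ f_cont f_pos.
  apply: measurable_funM; first exact: measurable_cst.
  by apply: measurable_funM; [exact: measurable_funB|exact: measurable_cst].
have qu xi : Rg xi -> (fun k => (q (u (k + N)%N) xi)%:E) @ \oo -->
    (g (alphaK (wulff Om f) xi) * SPsi_density Psi (wulff Om f) xi)%:E.
  move=> Rxi; apply: cvg_EFin; first exact: nearW.
  have /cvgr_dnbhsP/(_ u (conj une0 u0)) := F' xi Rxi.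
  rewrite -(cvg_shiftn N) => H.
  have := cvgM (cvg_cst (n%:R^-1 : R)) H; rewrite mulKf//.
  exact.
have iC : sph_measure.-integrable Rg (EFin \o cst (n%:R^-1 * C)).
  exact: (@bounded_integrable _ _ _ _ Rg (cst (n%:R^-1 * C)) `|n%:R^-1 * C| mRg
    (sph_measure_lty n0 Rg) (measurable_cst _) (fun _ _ => lexx _)).
have mL : measurable_fun Rg (fun xi : @SphType R n =>
    g (alphaK (wulff Om f) xi) * SPsi_density Psi (wulff Om f) xi).
  apply: measurable_funM.
    apply: (measurable_fun_regular n0 Om_sph Om_closed Om_nhemi f_cont f_pos).
    exact: (regular_comp_continuous n0 Om_sph Om_closed Om_nhemi f_cont f_pos g_cont).
  exact: (measurable_fun_SPsi_density n0 Psi_t_cont Psi_t_sign Om_sph Om_closed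
    Om_nhemi f_cont f_pos).
have qC k xi : Rg xi -> (`|(q (u (k + N)%N) xi)%:E| <= (n%:R^-1 * C)%:E)%E.
  move=> Rxi; rewrite lee_fin normrM ger0_norm ?invr_ge0// ler_wpM2l ?invr_ge0//.
  rewrite normrM normfV ler_pdivrMr ?normr_gt0//.
  exact: FC (ud k) (Sxi _ Rxi).
have [iL _ cvgI] := @dominated_convergence _ _ _ (@sph_measure R n) Rg mRg
  (fun k xi => (q (u (k + N)%N) xi)%:E) _ (EFin \o cst (n%:R^-1 * C))
  (fun k => (measurable_EFinP _ _).2 (mq k)) ((measurable_EFinP _ _).2 mL)
  (aeW _ qu) iC (aeW _ (fun xi k => qC k xi)).
apply: fine_cvg; rewrite /Rintegral fineK; last exact: (integrable_fin_num mRg iL).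
exact: cvgI.
Qed.
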